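(* Let $I\subseteq(0,\infty)$ be an interval and let $f:I\to(0,\infty)$ be an operator geometrically convex function. Let $A,B\in B(H)^{++}$ with $\operatorname{Sp}(A),\operatorname{Sp}(B)\subseteq I$. Then $$f(A\sharp B)\leq \int_0^1 f(A\sharp_t B)\,dt\leq \int_0^1 f(A)\sharp_t f(B)\,dt.$$ Moreover, if $f(A)\leq f(B)$, then $$\int_0^1 f(A\sharp_t B)\,dt\leq \int_0^1 f(A)\sharp_t f(B)\,dt\leq \frac12\bigl((f(A)\sharp f(B))+f(B)\bigr).$$
   Context: $H$ is a complex Hilbert space, $B(H)$ the $C^*$-algebra of bounded linear operators on $H$, and $\operatorname{Sp}(A)$ is the spectrum of $A$. $B(H)^{++}$ is the set of strictly positive operators, i.e. $A\in B(H)$ with $\langle Ax,x\rangle>0$ for all nonzero $x\in H$ (if moreover $\operatorname{Sp}(A)\subseteq(0,\infty)$, then $A$ is invertible). The order $\leq$ is the usual operator order on self-adjoint operators, and $f(A)$ is defined by the continuous functional calculus. For positive invertible $A,B$ and $t\in[0,1]$, the $t$-geometric mean is $A\sharp_t B=A^{1/2}(A^{-1/2}BA^{-1/2})^tA^{1/2}$, and $A\sharp B=A\sharp_{1/2}B$. If $\operatorname{Sp}(A),\operatorname{Sp}(B)\subseteq I$ then $\operatorname{Sp}(A\sharp_t B)\subseteq I$, so $f(A\sharp_t B)$ is defined. A continuous function $f:I\to(0,\infty)$ is operator geometrically convex if $f(A\sharp_t B)\leq f(A)\sharp_t f(B)$ for all $t\in[0,1]$ and all $A,B\in B(H)^{++}$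 with $\operatorname{Sp}(A),\operatorname{Sp}(B)\subseteq I$. Integrals are of norm-continuous $B(H)$-valued functions of $t$. *)

(* Defs.v *)
From HB Require Import structures.
From mathcomp Require Import all_boot all_order all_algebra.
From mathcomp Require Import complex.
From mathcomp Require Import all_classical all_reals all_analysis.

Set Implicit Arguments.
Unset Strict Implicit.
Unset Printing Implicit Defensive.

Import Order.TTheory GRing.Theory Num.Theory.
Import numFieldNormedType.Exports.

Local Open Scope classical_set_scope.
Local Open Scope ring_scope.
Local Open Scope complex_scope.

HB.mixin Record NormedModule_isHilbert (R : realType) H
    & CompleteNormedModule R[i] H := {
  inner : {dot H for Num.conj} ;
  normr_inner : forall x : H, `|x| ^+ 2 = inner x x
}.

#[short(type="hilbertType")]
HB.structure Definition Hilbert (R : realType) :=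
  {H of CompleteNormedModule R[i] H & NormedModule_isHilbert R H}.

(* Operators are plain functions H -> H, with the pointwise vector space       *)
(* structure of the library; their product is composition.                     *)
Section BoundedOperators.
Variables (R : realType) (H : hilbertType R).
Implicit Types (A B S T : H -> H) (f : R -> R).

Definition bounded_op : set (H -> H) := [set T | linear T /\ continuous T].

(* ||T|| <= e, in a form that also makes sense when T is not known to be       *)
(* bounded.                                                                    *)
Definition opnorm_le T (e : R) : Prop := forall x : H, `|T x| <= e%:C * `|x|.

Definition op_invertible T : Prop :=
  exists2 S, bounded_op S & S \o T = id /\ T \o S = id.

Definition Sp T : set R[i] := [set z | ~ op_invertible (z *: id - T)].

Definition Sp_sub T (I : interval R) : Prop :=
  Sp T `<=` [set x%:C | x in [set` I]].

(* For R[i], 0 < z and 0 <= z include that z is real.                          *)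
Definition strictly_positive T : Prop :=
  bounded_op T /\ forall x : H, x != 0 -> 0 < inner (T x) x.

Definition op_le A B : Prop := forall x : H, 0 <= inner ((B - A) x) x.

Definition poly_op (p : {poly R}) T : H -> H :=
  \sum_(i < size p) (p`_i)%:C *: iter i T.

(* The continuous functional calculus of a self-adjoint T is the extension by  *)
(* continuity of p |-> p(T), from real polynomials with the sup norm on the    *)
(* spectrum to operators with the operator norm. For self-adjoint T and f      *)
(* continuous on the spectrum, S exists and is unique, so the default value of *)
(* xget in cfc is not used; likewise in opint for norm-continuous F.           *)
Definition is_cfc f T S : Prop :=
  exists2 p : nat -> {poly R},
    {uniform [set x | Sp T x%:C], (fun n => horner (p n)) @ \oo --> f} &
    forall e : R, 0 < e ->
      \forall n \near \oo, opnorm_le (S - poly_op (p n) T) e.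

Definition cfc f T : H -> H := xget 0 [set S | is_cfc f T S].

Definition op_pow T (t : R) : H -> H := cfc (fun x => x `^ t) T.

Definition gmean (t : R) A B : H -> H :=
  op_pow A 2^-1 \o
  op_pow (op_pow A (- 2^-1) \o B \o op_pow A (- 2^-1)) t \o
  op_pow A 2^-1.

(* Riemann integral: limit in operator norm of the sums over the tagged        *)
(* partitions a = u 0 <= ... <= u n = b, with tags xi, as the mesh tends to 0. *)
Definition is_opint (F : R -> H -> H) (a b : R) S : Prop :=
  forall e : R, 0 < e -> exists2 d : R, 0 < d &
    forall (n : nat) (u xi : nat -> R),
      u 0%N = a -> u n = b ->
      (forall i, (i < n)%N -> u i <= xi i <= u i.+1 /\ u i.+1 - u i < d) ->
      opnorm_le (S - \sum_(i < n) (u i.+1 - u i)%:C *: F (xi i)) e.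

Definition opint (F : R -> H -> H) (a b : R) : H -> H :=
  xget 0 [set S | is_opint F a b S].

End BoundedOperators.

Definition op_geom_convex (R : realType) (H : hilbertType R)
    (I : interval R) (f : R -> R) : Prop :=
  [/\ {within [set` I], continuous f},
      forall x, x \in I -> 0 < f x &
      forall (t : R) (A B : H -> H), 0 <= t <= 1 ->
        strictly_positive A -> strictly_positive B ->
        Sp_sub A I -> Sp_sub B I ->
        op_le (cfc f (gmean t A B)) (gmean t (cfc f A) (cfc f B))].

(* Main.v *)
(* Let [C = f(A)], [D = f(B)]. Since [A # B = (A #_t B) # (A #_(1-t) B)], which
follows from the uniqueness of the positive solution of a Riccati equation,
convexity and the arithmetic-geometric mean inequality give
[2 f(A # B) <= f(A #_t B) + f(A #_(1-t) B)]; integrating in [t] yields the first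
inequality. The second one is convexity, integrated. If [C <= D] then
[C <= C # D], so that [C #_t D + C #_(1-t) D <= C + D <= C # D + D].

The functional calculus rests on the fact that the extreme values of the
numerical range of a self-adjoint operator are in its spectrum: a real polynomial
nonnegative on [Sp T] is therefore a positive operator at [T], which bounds
[p(T)] by the supremum of [|p|] on [Sp T]. *)
From HB Require Import structures.
Require Import Defs.
From mathcomp Require Import all_boot all_order all_algebra.
From mathcomp Require Import complex.
From mathcomp Require Import all_classical all_reals all_analysis.
From mathcomp Require Import ring lra zify.
Set Implicit Arguments.
Unset Strict Implicit.
Unset Printing Implicit Defensive.
Import Order.TTheory GRing.Theory Num.Theory.
Import numFieldNormedType.Exports.
Local Open Scope classical_set_scope.
Local Open Scope ring_scope.
Local Open Scope complex_scope.

(** * Real inner product and real norm *)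

(** [cfc] and [opint] are given by [xget]: nothing is known of them until a limit is shown to exist
    and to be unique. Both are rebuilt as norm limits in the ring [bop] of bounded operators, then
    identified with the given ones.

    Spectra are hard to follow through products and means. They are replaced by two-sided bounds on
    the quadratic form, [sa_within a b]; one compact interval [[a, b]] inside [I], with [0 < a],
    serves [A], [B] and all [A #_t B].

    Congruence by [A^(1/2)] carries [1], [X] and [X^t] to [A], [B] and [A #_t B], where
    [X = A^(-1/2) B A^(-1/2)]. Bounds on means thus reduce to the scalar inequality
    [x^t <= 1 - t + t x].

    The operators [A #_t B] need not commute for different [t], so norm continuity of [f(A #_t B)]
    in [t] cannot come from the calculus of a single operator; polynomial approximation of [f] gives
    it.

    Integrals are limits of midpoint sums, whose tags are invariant under [t |-> 1 - t]. A bound on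
    the sum of the values at [t] and [1 - t] thus passes to the integral without a change of
    variable. *)

Section RealInnerProduct.
Variables (R : realType) (H : hilbertType R).
Implicit Types (x y z : H) (r : R).

Definition nr x : R := complex.Re `|x|.
Definition rin x y : R := complex.Re (inner x y).

Lemma ReD (a b : R[i]) : complex.Re (a + b) = complex.Re a + complex.Re b.
Proof. by case: a; case: b. Qed.

Lemma ReZ r (a : R[i]) : complex.Re (r%:C * a) = r * complex.Re a.
Proof. by case: a => a b /=; rewrite mul0r subr0. Qed.

Lemma rcM r (s : R) : (r * s)%:C = r%:C * s%:C.
Proof. exact: rmorphM. Qed.

Lemma nrE x : `|x| = (nr x)%:C.
Proof. by rewrite /nr RRe_real // ger0_real. Qed.

Lemma nr_ge0 x : 0 <= nr x.
Proof. by rewrite -ler0c -nrE. Qed.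

Lemma nr0 : nr 0 = 0.
Proof. by rewrite /nr normr0. Qed.

Lemma nr_eq0 x : (nr x == 0) = (x == 0).
Proof. by rewrite -[RHS]normr_eq0 nrE -(inj_eq (@complexI R)). Qed.

Lemma nr_gt0 x : (0 < nr x) = (x != 0).
Proof. by rewrite lt0r nr_eq0 nr_ge0 andbT. Qed.

Lemma nrD x y : nr (x + y) <= nr x + nr y.
Proof. by rewrite -lecR rmorphD /= -!nrE ler_normD. Qed.

Lemma nrN x : nr (- x) = nr x.
Proof. by rewrite /nr normrN. Qed.

Lemma nrB x y : nr (x - y) <= nr x + nr y.
Proof. by rewrite (le_trans (nrD _ _))// nrN. Qed.

Lemma nrZ (c : R[i]) x : nr (c *: x) = complex.Re `|c| * nr x.
Proof.
by apply: (@complexI R); rewrite -nrE normrZ rcM RRe_real ?ger0_real// nrE.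
Qed.

Lemma nrZr r x : nr (r%:C *: x) = `|r| * nr x.
Proof. by rewrite nrZ normc_def /= expr0n addr0 sqrtr_sqr. Qed.

Lemma rinC x y : rin x y = rin y x.
Proof. by rewrite /rin hermC expr0 mul1r /=; case: (inner y x). Qed.

Lemma rinDl x y z : rin (x + y) z = rin x z + rin y z.
Proof. by rewrite /rin linearDl ReD. Qed.

Lemma rinDr x y z : rin z (x + y) = rin z x + rin z y.
Proof. by rewrite rinC rinDl !(rinC z). Qed.

Lemma rinZl r x y : rin (r%:C *: x) y = r * rin x y.
Proof.
by rewrite /rin linearZl_LR ReZ.
Qed.

Lemma rinZr r x y : rin y (r%:C *: x) = r * rin y x.
Proof. by rewrite rinC rinZl rinC. Qed.

Lemma rinNl x y : rin (- x) y = - rin x y.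
Proof. by rewrite -scaleN1r -(rmorph1 (real_complex R)) -rmorphN rinZl mulN1r. Qed.

Lemma rinNr x y : rin y (- x) = - rin y x.
Proof. by rewrite rinC rinNl rinC. Qed.

Lemma rinBl x y z : rin (x - y) z = rin x z - rin y z.
Proof. by rewrite rinDl rinNl. Qed.

Lemma rinBr x y z : rin z (x - y) = rin z x - rin z y.
Proof. by rewrite rinDr rinNr. Qed.

Lemma nr_sqr x : nr x ^+ 2 = rin x x.
Proof.
by rewrite /rin -normr_inner nrE -rmorphXn.
Qed.

Lemma rin_le x y : rin x y <= nr x * nr y.
Proof.
have /(lerXn2r 2) := nrD x y; rewrite !nnegrE nr_ge0 addr_ge0 ?nr_ge0//.
move=> /(_ isT isT); rewrite sqrrD !nr_sqr rinDl !rinDr (rinC y x).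
lra.
Qed.

Lemma rin_norm_le x y : `|rin x y| <= nr x * nr y.
Proof.
by rewrite ler_norml rin_le andbT lerNl -rinNl (le_trans (rin_le _ _))// nrN.
Qed.

Definition nle (T : H -> H) (e : R) := forall x, nr (T x) <= e * nr x.

Lemma opnorm_leE (T : H -> H) e : opnorm_le T e <-> nle T e.
Proof.
by split=> + x => /(_ x); rewrite !nrE -rmorphM lecR.
Qed.

Lemma bounded_opP (T : H -> H) :
  bounded_op T <-> linear T /\ exists2 M, 0 <= M & nle T M.
Proof.
split=> [[linT cT]|[linT [M M0 TM]]]; split => //.
  pose L : {linear H -> H} := HB.pack T (GRing.isLinear.Build _ _ _ _ _ linT).
  have /linear_boundedP[M [Mreal LM]] : bounded_near L (nbhs 0).
    by apply: continuous_linear_bounded; exact: (cT 0).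
  (* The library bound holds for every constant strictly above [M], hence the [+ 1]. *)
  exists (`|complex.Re M| + 1); first by rewrite addr_ge0.
  move=> x; rewrite -lecR rmorphM/= -!nrE.
  apply: (LM _ _ x).
  rewrite -[M]RRe_real// ltcR (le_lt_trans (ler_norm _))//.
  by rewrite ltrDl.
pose L : {linear H -> H} := HB.pack T (GRing.isLinear.Build _ _ _ _ _ linT).
apply: (@bounded_linear_continuous _ _ _ L); apply/linear_boundedP.
exists M%:C; split; first by rewrite complex_real.
move=> r Mr x; rewrite (le_trans _ (ler_wpM2r _ (ltW Mr)))//.
by rewrite !nrE -rmorphM lecR.
Qed.

End RealInnerProduct.

(** * The algebra of bounded operators *)

Section BoundedOperatorAlgebra.
Variables (R : realType) (H : hilbertType R).

Definition bounded_pred : {pred H -> H} := fun T => `[< bounded_op T >].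

Lemma bounded_pred_submod : submod_closed bounded_pred.
Proof.
split.
  apply/asboolP/bounded_opP; split; first by move=> a x y; rewrite scaler0 addr0.
  by exists 0 => // x; rewrite mul0r nr0.
move=> a S T /asboolP/bounded_opP[linS [M M0 SM]]
  /asboolP/bounded_opP[linT [N N0 TN]].
apply/asboolP/bounded_opP; split.
  move=> c x y; rewrite !fctE linS linT !scalerDr !scalerA.
  by rewrite addrACA (mulrC a).
exists (complex.Re `|a| * M + N).
  by rewrite addr_ge0// mulr_ge0// -ler0c RRe_real ?ger0_real.
move=> x; rewrite (le_trans (nrD _ _))// mulrDl lerD// nrZ -mulrA ler_wpM2l//.
by rewrite -ler0c RRe_real ?ger0_real.
Qed.

HB.instance Definition _ := GRing.isSubmodClosed.Build R[i] (H -> H) bounded_pred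
  bounded_pred_submod.

(* The type depends on a proof that [H] is not trivial because rings must
satisfy [1 != 0]. *)
Record bop (H_nt : exists x : H, x != 0) :=
  Bop { bfun :> H -> H; bfun_bounded : bounded_pred bfun }.

Variable H_nt : exists x : H, x != 0.

HB.instance Definition _ := [isSub for @bfun H_nt].
HB.instance Definition _ := [Choice of bop H_nt by <:].
HB.instance Definition _ := [SubChoice_isSubLmodule of bop H_nt by <:].

Local Notation B := (bop H_nt).
Implicit Types (S T U : B).

Lemma bopP T : bounded_op T.
Proof. exact/asboolP/bfun_bounded. Qed.

Lemma bop_linear T : linear T.
Proof. by have [] := bopP T. Qed.

HB.instance Definition _ T := GRing.isLinear.Build R[i] H H *:%R T (bop_linear T).

Lemma bop_ext S T : S =1 T -> S = T.
Proof. by move=> ST; apply/val_inj/funext. Qed.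

Lemma bop_bound T : exists2 M, 0 < M & nle T M.
Proof.
have /bounded_opP[_ [M M0 TM]] := bopP T; exists (M + 1); first by lra.
by move=> x; rewrite (le_trans (TM x))// ler_wpM2r ?nr_ge0//; lra.
Qed.

Definition mkbop (T : H -> H) (bT : bounded_op T) : B := Bop H_nt (asboolT bT).

Lemma id_bounded : bounded_op (@id H).
Proof.
by apply/bounded_opP; split=> //; exists 1 => // x; rewrite mul1r.
Qed.

Lemma comp_bounded S T : bounded_op (S \o T).
Proof.
apply/bounded_opP; split; first by move=> a x y /=; rewrite !linearP.
have [M M0 SM] := bop_bound S; have [N N0 TN] := bop_bound T.
exists (M * N); first by rewrite mulr_ge0 ?ltW.
by move=> x /=; rewrite (le_trans (SM _))// -mulrA ler_pM2l.
Qed.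

Definition bmul S T : B := mkbop (comp_bounded S T).
Definition bone : B := mkbop id_bounded.

Lemma bmulA : associative bmul. Proof. by move=> S T U; exact: bop_ext. Qed.
Lemma bmul1l : left_id bone bmul. Proof. by move=> T; exact: bop_ext. Qed.
Lemma bmul1r : right_id bone bmul. Proof. by move=> T; exact: bop_ext. Qed.
Lemma bmulDl : left_distributive bmul +%R.
Proof. by move=> S T U; exact: bop_ext. Qed.
Lemma bmulDr : right_distributive bmul +%R.
Proof. by move=> S T U; apply: bop_ext => x /=; rewrite raddfD. Qed.
Lemma bone_neq0 : bone != 0.
Proof.
have [x x0] := H_nt; apply: contra x0 => /eqP /(congr1 (fun T : B => T x)).
by move=> /= ->.
Qed.

HB.instance Definition _ :=
  GRing.Zmodule_isNzRing.Build B bmulA bmul1l bmul1r bmulDl bmulDr bone_neq0.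

Lemma bscaleAl (a : R[i]) S T : a *: (S * T) = (a *: S) * T.
Proof. exact: bop_ext. Qed.
HB.instance Definition _ := GRing.Lmodule_isLalgebra.Build R[i] B bscaleAl.
Lemma bscaleAr (a : R[i]) S T : a *: (S * T) = S * (a *: T).
Proof. by apply: bop_ext => x /=; rewrite linearZ. Qed.
HB.instance Definition _ := GRing.Lalgebra_isAlgebra.Build R[i] B bscaleAr.

Lemma bopD T x y : T (x + y) = T x + T y. Proof. exact: raddfD. Qed.
Lemma bopB T x y : T (x - y) = T x - T y. Proof. exact: raddfB. Qed.
Lemma bopZ T (a : R[i]) x : T (a *: x) = a *: T x. Proof. exact: linearZ. Qed.
Lemma bop_addE S T x : (S + T) x = S x + T x. Proof. by []. Qed.
Lemma bop_oppE T x : (- T) x = - T x. Proof. by []. Qed.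
Lemma bop_subE S T x : (S - T) x = S x - T x. Proof. by []. Qed.
Lemma bop_scaleE a T x : (a *: T) x = a *: T x. Proof. by []. Qed.
Lemma bop_mulE S T x : (S * T) x = S (T x). Proof. by []. Qed.
Lemma bop_0E x : (0 : B) x = 0. Proof. by []. Qed.

(** Going through [horner_alg] makes [p |-> p(T)] a ring morphism, so sums and products of
    polynomials need no computation with coefficients. *)
Definition evalp (p : {poly R}) T : B :=
  horner_alg T (map_poly (real_complex R) p).

Lemma bfun_sum (I : Type) (r : seq I) (F : I -> B) :
  bfun (\sum_(i <- r) F i) = \sum_(i <- r) bfun (F i).
Proof. by elim/big_rec2: _ => //= i x y _ <-. Qed.

Lemma bfun_exp T n x : (T ^+ n) x = iter n T x.
Proof. by elim: n x => // n IH x; rewrite exprS bop_mulE IH. Qed.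

Lemma poly_op_evalp p T : poly_op p T = evalp p T.
Proof.
rewrite /poly_op /evalp /horner_alg /horner_morph horner_coef.
rewrite size_map_poly size_map_poly bfun_sum; apply: eq_bigr => i _.
rewrite !coef_map_id0 //=; last exact: scale0r.
apply/funext => x.
by rewrite fctE /= bfun_exp.
Qed.

End BoundedOperatorAlgebra.

(** * Self-adjoint operators *)

Section OperatorTheory.
Variables (R : realType) (H : hilbertType R) (H_nt : exists x : H, x != 0).
Local Notation B := (bop H_nt).
Implicit Types (S T U : B) (x y z : H) (r a b c : R).

Definition inv_op T := exists S, S * T = 1 /\ T * S = 1.
(** The real part is enough: [T] is complex linear, so replacing [x] by ['i *: x] yields the
    imaginary part. *)
Definition sa T := forall x y, rin (T x) y = rin x (T y).
Definition qf T x := rin (T x) x.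
Definition ple S T := forall x, qf S x <= qf T x.

Lemma nle_weak (T : H -> H) a b : a <= b -> nle T a -> nle T b.
Proof. by move=> ab Ta x; rewrite (le_trans (Ta x))// ler_wpM2r// nr_ge0. Qed.

Lemma nle_add S T a b : nle S a -> nle T b -> nle (S + T) (a + b).
Proof.
by move=> Sa Tb x; rewrite (le_trans (nrD _ _))// mulrDl; apply: lerD; [exact: Sa|exact: Tb].
Qed.

Lemma nle_opp T a : nle T a -> nle (- T) a.
Proof. by move=> Ta x; rewrite bop_oppE nrN. Qed.

Lemma nle_sub S T a b : nle S a -> nle T b -> nle (S - T) (a + b).
Proof. by move=> Sa Tb; apply: nle_add => //; exact: nle_opp. Qed.

Lemma nle_sym S T a : nle (S - T) a -> nle (T - S) a.
Proof. by move=> ST; rewrite -opprB; exact: nle_opp. Qed.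

Lemma nle_trans S T U a b : nle (S - T) a -> nle (T - U) b -> nle (S - U) (a + b).
Proof. by move=> ST TU; rewrite -(subrKA T); exact: nle_add. Qed.

Lemma nle_mul S T a b : 0 <= a -> nle S a -> nle T b -> nle (S * T) (a * b).
Proof.
by move=> a0 Sa Tb x; rewrite bop_mulE (le_trans (Sa _))// -mulrA ler_wpM2l.
Qed.

Lemma nle_1 : nle (1 : B) 1.
Proof. by move=> x; rewrite mul1r. Qed.

Lemma nle_scale T r a : nle T a -> nle (r%:C *: T) (`|r| * a).
Proof. by move=> Ta x; rewrite bop_scaleE nrZr -mulrA ler_wpM2l. Qed.

Lemma nle_exp T a n : 0 <= a -> nle T a -> nle (T ^+ n) (a ^+ n).
Proof.
move=> a0 Ta; elim: n => [|n IH]; first by rewrite !expr0; exact: nle_1.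
by rewrite !exprS; exact: nle_mul.
Qed.

(** About plain functions, because the uniqueness of [cfc] and [opint] concerns candidates not known
    to be bounded. *)
Lemma nle_small (S T : H -> H) : (forall e, 0 < e -> nle (S - T) e) -> S = T.
Proof.
move=> ST; apply/funext => x; apply/eqP; rewrite -subr_eq0 -nr_eq0.
rewrite eq_le nr_ge0 andbT; apply/ler_addgt0Pl => e e0; rewrite addr0.
have e1 : 0 < e / (nr x + 1) by rewrite divr_gt0// ltr_wpDl// nr_ge0.
rewrite (le_trans (ST _ e1 x))// -mulrA ger_pMr//.
by rewrite mulrC ler_pdivrMr ?mul1r ?lerDl// ltr_wpDl// nr_ge0.
Qed.

Lemma nle_qf T a x : nle T a -> `|qf T x| <= a * nr x ^+ 2.
Proof.
by move=> Ta; rewrite (le_trans (rin_norm_le _ _))// expr2 mulrA ler_wpM2r ?nr_ge0.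
Qed.

Lemma qf_add S T x : qf (S + T) x = qf S x + qf T x.
Proof. by rewrite /qf bop_addE rinDl. Qed.
Lemma qf_opp T x : qf (- T) x = - qf T x.
Proof. by rewrite /qf bop_oppE rinNl. Qed.
Lemma qf_sub S T x : qf (S - T) x = qf S x - qf T x.
Proof. by rewrite qf_add qf_opp. Qed.
Lemma qf_scale r T x : qf (r%:C *: T) x = r * qf T x.
Proof. by rewrite /qf bop_scaleE rinZl. Qed.
Lemma qf_1 x : qf 1 x = nr x ^+ 2.
Proof. by rewrite nr_sqr. Qed.
Lemma qf_0 x : qf 0 x = 0.
Proof. by rewrite -(scale0r (1 : B)) -(rmorph0 (real_complex R)) qf_scale mul0r. Qed.
Definition qfE := (qf_sub, qf_opp, qf_add, qf_scale, qf_1, qf_0).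

Lemma sa_0 : sa 0.
Proof. by move=> x y; rewrite !bop_0E rinC -(scale0r (0 : H)) -(rmorph0 (real_complex R)) rinZr rinZr !mul0r. Qed.
Lemma sa_1 : sa 1. Proof. by []. Qed.
Lemma sa_add S T : sa S -> sa T -> sa (S + T).
Proof. by move=> sS sT x y; rewrite !bop_addE rinDl rinDr sS sT. Qed.
Lemma sa_opp T : sa T -> sa (- T).
Proof. by move=> sT x y; rewrite !bop_oppE rinNl rinNr sT. Qed.
Lemma sa_sub S T : sa S -> sa T -> sa (S - T).
Proof. by move=> sS sT; apply: sa_add => //; exact: sa_opp. Qed.
Lemma sa_scale r T : sa T -> sa (r%:C *: T).
Proof. by move=> sT x y; rewrite !bop_scaleE rinZl rinZr sT. Qed.
Lemma sa_conj S T : sa S -> sa T -> sa (S * T * S).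
Proof. by move=> sS sT x y; rewrite !bop_mulE sS sT sS. Qed.
Lemma sa_mul S T : sa S -> sa T -> S * T = T * S -> sa (S * T).
Proof. by move=> sS sT ST x y; rewrite {2}ST !bop_mulE sS sT. Qed.

Lemma qf_conj S T x : sa S -> qf (S * T * S) x = qf T (S x).
Proof. by move=> sS; rewrite /qf !bop_mulE sS. Qed.
Lemma qf_mulr T x : sa T -> qf (T * T) x = nr (T x) ^+ 2.
Proof. by move=> sT; rewrite /qf bop_mulE sT nr_sqr. Qed.

Lemma evalpD p q T : evalp (p + q) T = evalp p T + evalp q T.
Proof. by rewrite /evalp !rmorphD. Qed.
Lemma evalpB p q T : evalp (p - q) T = evalp p T - evalp q T.
Proof. by rewrite /evalp !rmorphB. Qed.
Lemma evalpM p q T : evalp (p * q) T = evalp p T * evalp q T.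
Proof. by rewrite /evalp !rmorphM. Qed.
Lemma evalpX T : evalp 'X T = T.
Proof. by rewrite /evalp map_polyX horner_algX. Qed.
Lemma evalpC r T : evalp r%:P T = r%:C *: 1.
Proof. by rewrite /evalp map_polyC horner_algC. Qed.

Lemma sa_evalp p T : sa T -> sa (evalp p T).
Proof.
move=> sT; elim/poly_ind: p => [|p c IH]; first by rewrite /evalp !rmorph0; exact: sa_0.
rewrite evalpD evalpM evalpX evalpC; apply: sa_add; last exact: sa_scale.
by apply: sa_mul => //; rewrite -{2 3}(evalpX T) -!evalpM mulrC.
Qed.

Lemma comm_evalp p S T : S * T = T * S -> S * evalp p T = evalp p T * S.
Proof.
move=> ST; elim/poly_ind: p => [|p c IH]; first by rewrite /evalp !rmorph0 mul0r mulr0.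
rewrite evalpD evalpM evalpX evalpC mulrDr mulrDl mulrA IH -mulrA ST mulrA.
by rewrite -scalerAl -scalerAr mul1r mulr1.
Qed.

(* Polarization of [4 <Tx, y>] at [y] proportional to [Tx] with [|y| = |x|]. *)
Lemma sa_norm_le T c : 0 <= c -> sa T ->
  (forall x, `|qf T x| <= c * nr x ^+ 2) -> nle T c.
Proof.
move=> c0 sT Tc x.
have [->|x0] := eqVneq x 0; first by rewrite raddf0 nr0 mulr0.
have [->|Tx0] := eqVneq (T x) 0; first by rewrite nr0 mulr_ge0// nr_ge0.
rewrite -nr_gt0 in x0; rewrite -nr_gt0 in Tx0.
pose y := (nr x / nr (T x))%:C *: T x.
have nry : nr y = nr x by rewrite nrZr ger0_norm ?divr_ge0 ?nr_ge0// divfK ?gt_eqF.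
have rxy : rin (T x) y = nr x * nr (T x).
  by rewrite rinZr -nr_sqr expr2 mulrA divfK ?gt_eqF.
have ryx : rin (T y) x = nr x * nr (T x) by rewrite sT rinC.
have := Tc (x + y); have := Tc (x - y).
have TD : T (x + y) = T x + T y by rewrite raddfD.
have TB : T (x - y) = T x - T y by rewrite raddfB.
rewrite !ler_norml /qf !nr_sqr TD TB.
rewrite !(rinDl, rinDr, rinNl, rinNr, opprK) rxy ryx (rinC y x) -!nr_sqr nry.
move=> /andP[h1 _] /andP[_ h2].
rewrite -(ler_pM2l x0); nra.
Qed.

Lemma sa_lim S : (forall e, 0 < e -> exists2 T, sa T & nle (S - T) e) -> sa S.
Proof.
move=> lS x y; apply/eqP; rewrite -subr_eq0 -normr_eq0 eq_le normr_ge0 andbT.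
apply/ler_addgt0Pl => d d0; rewrite addr0.
have nxy : 0 <= nr x * nr y by rewrite mulr_ge0// nr_ge0.
have k0 : 0 < 2 * (nr x * nr y + 1) by lra.
have [T sT ST] := lS _ (divr_gt0 d0 k0).
set e := d / _ in ST.
(* [T] is symmetric, so the defect of symmetry of [S] is that of the small operator [S - T]. *)
have -> : rin (S x) y - rin x (S y) = rin ((S - T) x) y - rin x ((S - T) y).
  by rewrite !bop_subE rinBl rinBr sT; ring.
have h1 := rin_norm_le ((S - T) x) y.
have h2 := rin_norm_le x ((S - T) y).
have h3 : nr ((S - T) x) * nr y <= e * nr x * nr y by rewrite ler_wpM2r ?nr_ge0.
have h4 : nr x * nr ((S - T) y) <= nr x * (e * nr y) by rewrite ler_wpM2l ?nr_ge0.
have -> : d = e * (2 * (nr x * nr y + 1)) by rewrite divfK// gt_eqF.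
have e0 : 0 < e by rewrite divr_gt0.
rewrite (le_trans (ler_normB _ _))//; nra.
Qed.

Lemma qf_lim_ge S x c :
  (forall e, 0 < e -> exists2 T, c <= qf T x & nle (S - T) e) -> c <= qf S x.
Proof.
move=> lS; apply/ler_addgt0Pr => d d0.
have k0 : 0 < nr x ^+ 2 + 1 by rewrite ltr_wpDl// sqr_ge0.
have [T cT ST] := lS _ (divr_gt0 d0 k0).
have := nle_qf x ST; rewrite qfE ler_norml => /andP[h _].
have : d / (nr x ^+ 2 + 1) * nr x ^+ 2 <= d.
  by rewrite mulrAC ler_pdivrMr// ler_pM2l// lerDl.
lra.
Qed.

Lemma bop_complete (S : nat -> B) :
  (forall e, 0 < e -> exists N, forall m n, (N <= m)%N -> (N <= n)%N ->
     nle (S m - S n) e) ->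
  exists T, forall e, 0 < e -> exists N, forall n, (N <= n)%N -> nle (T - S n) e.
Proof.
move=> Sc.
have cvgS x : cvg (S n x @[n --> \oo]).
  apply/cauchy_cvgP/cauchy_exP => e e0.
  have e0' : 0 < complex.Re e by rewrite -ltcR RRe_real// gtr0_real.
  have : 0 < complex.Re e / (nr x + 1) by rewrite divr_gt0// ltr_wpDl// nr_ge0.
  move=> /Sc[N SN]; exists (S N x); exists N => // n /= Nn.
  rewrite -ball_normE /ball_/= nrE -[e]RRe_real ?gtr0_real// ltcR.
  rewrite (le_lt_trans (SN N n _ _ x))//.
  rewrite mulrAC ltr_pdivrMr ?ltr_wpDl ?nr_ge0// ltr_pM2l// ltrDl//.
have {}cvgS x : {l | S n x @[n --> \oo] --> l /\
    forall d, 0 < d -> exists N, forall n, (N <= n)%N -> nr (l - S n x) <= d}.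
  exists (lim (S n x @[n --> \oo])); split; first exact: cvgS.
  move=> d d0; have /cvgrPdist_le/(_ d%:C) := cvgS x.
  rewrite ltcR => /(_ d0)[N _ SN]; exists N => n Nn.
  by rewrite -lecR -nrE; exact: SN.
pose L x := sval (cvgS x).
have LP x : S n x @[n --> \oo] --> L x by have [] := svalP (cvgS x).
have Ld x : forall d, 0 < d -> exists N, forall n, (N <= n)%N ->
  nr (L x - S n x) <= d by have [] := svalP (cvgS x).
have Lb e : 0 < e -> exists N, forall n, (N <= n)%N -> nle (L - S n) e.
  move=> /Sc[N SN]; exists N => n Nn x.
  apply/ler_addgt0Pl => d d0.
  have [M LM] := Ld x d d0.
  (* The intermediate index depends on [x], but its contribution [d] is arbitrary, so the bound [e]
     remains uniform in [x]. *)
  have -> : (L - bfun (S n)) x = (L x - S (maxn M N) x) + (S (maxn M N) - S n) x.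
    by rewrite bop_subE subrKA.
  rewrite (le_trans (nrD _ _))// lerD//; first exact/LM/leq_maxl.
  exact/SN/Nn/leq_maxr.
have linL : linear L.
  move=> a x y; apply: (cvg_unique _ (LP _)) => //=.
  have -> : (fun n => S n (a *: x + y)) = (fun n => a *: S n x + S n y).
    by apply/funext => n; rewrite linearP.
  by apply: cvgD => //; exact: cvgZl_tmp.
have bL : bounded_op L.
  apply/bounded_opP; split => //; have [N /(_ N (leqnn _)) LN] := Lb 1 ltr01.
  have [M M0 SM] := bop_bound (S N); exists (1 + M); first by lra.
  move=> x; have -> : L x = (L - bfun (S N)) x + S N x by rewrite [X in X + _]/= subrK.
  by rewrite (le_trans (nrD _ _))// mulrDl lerD.
by exists (mkbop H_nt bL).
Qed.

End OperatorTheory.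

(** * Spectrum and numerical range *)

Section Spectrum.
Variables (R : realType) (H : hilbertType R) (H_nt : exists x : H, x != 0).
Local Notation B := (bop H_nt).
Implicit Types (K P S T U : B) (x y z : H) (r a b c q : R).

Lemma expr_small q e : 0 <= q < 1 -> 0 < e ->
  exists N, forall n, (N <= n)%N -> q ^+ n <= e.
Proof.
move=> /andP[q0 q1] e0.
have /cvgrPdist_le/(_ e e0)[N _ qN] : (fun n => q ^+ n) @ \oo --> (0 : R).
  by apply: cvg_expr; rewrite ger0_norm.
exists N => n Nn; have := qN n Nn.
by rewrite /= sub0r normrN ger0_norm// exprn_ge0.
Qed.

(** The inverse is the sum of the geometric series. The recursion [s n.+1 = 1 + K * s n] bounds all
    partial sums by [(1 - q)^-1], whence the Cauchy property. *)
Lemma neumann K q : 0 <= q < 1 -> nle K q -> inv_op (1 - K).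
Proof.
move=> q01 Kq; have /andP[q0 q1] := q01.
have q1' : 0 < 1 - q by rewrite subr_gt0.
pose s n : B := \sum_(i < n) K ^+ i.
have sb n : nle (s n) (1 - q)^-1.
  elim: n => [|n IH]; first by move=> x; rewrite /s big_ord0 bop_0E nr0 mulr_ge0 ?nr_ge0// invr_ge0 ltW.
  have -> : s n.+1 = 1 + K * s n.
    by rewrite /s big_ord_recl expr0 mulr_sumr; congr (_ + _); apply: eq_bigr => i _; rewrite -exprS.
  have -> : (1 - q)^-1 = 1 + q * (1 - q)^-1 by field; rewrite gt_eqF.
  by apply: nle_add; [exact: nle_1|exact: nle_mul].
have sD n k : s (n + k)%N - s n = K ^+ n * s k.
  rewrite /s big_split_ord /= [X in X - _]addrC addrK mulr_sumr.
  by apply: eq_bigr => i _; rewrite -exprD.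
have cauchy_s e : 0 < e -> exists N, forall m n, (N <= m)%N -> (N <= n)%N ->
    nle (s m - s n) e.
  move=> e0; have [N qN] := expr_small q01 (mulr_gt0 e0 q1').
  have H1 m n : (N <= n)%N -> (n <= m)%N -> nle (s m - s n) e.
    move=> Nn nm; rewrite -(subnKC nm) sD.
    apply: (@nle_weak _ _ _ (q ^+ n * (1 - q)^-1)).
      by rewrite ler_pdivrMr// qN.
    by apply: nle_mul => //; [exact: exprn_ge0|exact: nle_exp].
  exists N => m n Nm Nn; have [mn|/ltnW nm] := leqP m n; last exact: H1.
  by apply: nle_sym; exact: H1.
have [T sT] := bop_complete cauchy_s.
have ms n : (1 - K) * s n = 1 - K ^+ n.
  by rewrite /s -[RHS]opprB subrX1 -mulNr opprB.
have sm n : s n * (1 - K) = 1 - K ^+ n.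
  rewrite -ms /s mulr_sumr mulr_suml; apply: eq_bigr => i _.
  by rewrite mulrBl mulrBr mul1r mulr1 -exprSr -exprS.
have K1 : nle (1 - K) (1 + q) by apply: nle_sub; [exact: nle_1|].
(* The two products of [s n] with [1 - K] equal [1 - K ^+ n], which tends to 1; [small] treats both
   sides of the inverse at once. *)
have small (X : nat -> B) (L : B) (M : R) : 0 <= M ->
    (forall n d, 0 < d -> nle (T - s n) d -> nle (L - X n) (M * d)) ->
    (forall n, X n = 1 - K ^+ n) -> L = 1.
  move=> M0 LX XK; apply/val_inj/nle_small => e e0 /=.
  have M1 : 0 < M + 1 by lra.
  have [N1 TN] := sT (e / (M + 1) / 2) (divr_gt0 (divr_gt0 e0 M1) (ltr0Sn _ 1)).
  have [N2 qN] := expr_small q01 (divr_gt0 e0 (ltr0Sn _ 1) : 0 < e / 2).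
  pose n := maxn N1 N2.
  have h1 : nle (L - X n) (M * (e / (M + 1) / 2)) by apply/LX/TN/leq_maxl; rewrite !divr_gt0.
  have h2 : nle (X n - 1) (e / 2).
    rewrite XK addrAC subrr sub0r; apply/nle_opp.
    apply: nle_weak (qN n (leq_maxr _ _)) _; exact: nle_exp.
  apply: nle_weak (nle_trans h1 h2).
  have -> : M * (e / (M + 1) / 2) = (M / (M + 1)) * (e / 2) by field; rewrite gt_eqF.
  have : M / (M + 1) <= 1 by rewrite ler_pdivrMr//; lra.
  nra.
exists T; split.
  apply: (small (fun n => s n * (1 - K)) _ (1 + q)) => //; first by lra.
  by move=> n d d0 Td; rewrite -mulrBl mulrC; apply: nle_mul => //; exact: ltW.
apply: (small (fun n => (1 - K) * s n) _ (1 + q)) => //; first by lra.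
by move=> n d d0 Td; rewrite -mulrBr; apply: nle_mul => //; lra.
Qed.

Lemma inv_op_scale (c : R[i]) T : c != 0 -> inv_op T -> inv_op (c *: T).
Proof.
move=> c0 [S [ST TS]]; exists (c^-1 *: S).
by rewrite -!scalerAl -!scalerAr ST TS !scalerA mulVf ?mulfV// scale1r.
Qed.

Lemma inv_op_mul S T : inv_op S -> inv_op T -> inv_op (S * T).
Proof.
move=> [S' [S'S SS']] [T' [T'T TT']]; exists (T' * S'); split.
  by rewrite mulrA -(mulrA T') S'S mulr1.
by rewrite mulrA -(mulrA S) TT' mulr1.
Qed.

(** If [U] inverts [S * T], then [U * T] is a left inverse and [T * U] a right inverse of [S], so
    they coincide. *)
Lemma inv_op_mulW S T : S * T = T * S -> inv_op (S * T) -> inv_op S.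
Proof.
move=> ST [U [U1 U2]]; exists (U * T).
have UT : U * T = T * U.
  have : U * T * (S * (T * U)) = U * T by rewrite (mulrA S) U2 mulr1.
  by rewrite mulrA -(mulrA U) -ST U1 mul1r => <-.
split; last by rewrite UT mulrA.
by rewrite -mulrA -ST.
Qed.

Lemma mul_sum_diff S T : S * T = T * S -> (S + T) * (S - T) = S * S - T * T.
Proof. by move=> ST; rewrite mulrDl !mulrBr ST addrA subrK. Qed.

Lemma mul_diff_sum S T : S * T = T * S -> (S - T) * (S + T) = S * S - T * T.
Proof. by move=> ST; rewrite mulrBl !mulrDr ST opprD addrA addrK. Qed.

Lemma inv_opN T : inv_op (- T) <-> inv_op T.
Proof.
have N1 : -1 != 0 :> R[i] by rewrite oppr_eq0 oner_eq0.
by split=> /(inv_op_scale N1); rewrite scaleN1r ?opprK.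
Qed.

(** For [M] large, [1 - P / M] has its quadratic form between 0 and [1 - c / M], hence norm below 1,
    and the Neumann series inverts [P / M]. *)
Lemma coercive_inv P c : 0 < c -> sa P ->
  (forall x, c * nr x ^+ 2 <= qf P x) -> inv_op P.
Proof.
move=> c0 sP Pc; have [M0 M0_gt0 PM0] := bop_bound P.
(* The summand [c] ensures [c < M], so that [1 - c / M] is a valid ratio. *)
pose M := M0 + c.
have M_gt0 : 0 < M by rewrite /M; lra.
have PM x : qf P x <= M * nr x ^+ 2.
  rewrite (le_trans (ler_norm _))// (le_trans (nle_qf _ PM0))//.
  by rewrite ler_wpM2r ?sqr_ge0// /M lerDl ltW.
have -> : P = M%:C *: (1 - (1 - M^-1%:C *: P)).
  rewrite opprB addrCA subrr addr0 scalerA -rcM divff ?gt_eqF//.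
  by rewrite scale1r.
apply: inv_op_scale; first by rewrite fmorph_eq0 gt_eqF.
apply: (@neumann _ (1 - c / M)).
  by rewrite subr_ge0 ler_pdivrMr// gtrBl divr_gt0// mul1r /M ltW//=; lra.
apply: sa_norm_le; first by rewrite subr_ge0 ler_pdivrMr// /M; lra.
  by apply: sa_sub; [exact: sa_1|exact: sa_scale].
move=> x; rewrite !qfE ger0_norm.
  rewrite mulrBl mul1r lerD2l lerN2 (mulrC c) -mulrA ler_pM2l ?invr_gt0//.
by rewrite subr_ge0 mulrC ler_pdivrMr// mulrC.
Qed.

Lemma SpE T (z : R[i]) : Sp T z <-> ~ inv_op (z%:A - T).
Proof.
have E : z *: id - bfun T = z%:A - T by apply/funext.
split=> hz hi; apply: hz.
  rewrite E; have [S [S1 S2]] := hi; exists S; first exact: bopP.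
  by split; [exact: (congr1 (@bfun _ _ _) S1)|exact: (congr1 (@bfun _ _ _) S2)].
move: hi; rewrite E => -[S bS [S1 S2]]; exists (mkbop H_nt bS).
by split; apply/val_inj; [exact: S1|exact: S2].
Qed.

(* [(z - T) (z^* - T) = (a - T)^2 + b^2] is coercive when [b != 0]. *)
Lemma Sp_real T (z : R[i]) : sa T -> Sp T z -> z = (complex.Re z)%:C.
Proof.
move=> sT /SpE zT; case: z zT => a b zT /=.
have [->//|b0] := eqVneq b 0; exfalso; apply: zT.
pose z := a +i* b; pose A : B := a%:C%:A - T; pose C : B := ('i * b%:C)%:A.
have AC : A * C = C * A by rewrite /C -!scalerAl -!scalerAr mul1r mulr1.
have -> : (a +i* b)%:A - T = A + C.
  by rewrite [a +i* b]complexE /= scalerDl addrAC.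
apply: (@inv_op_mulW _ (A - C)).
  by rewrite mul_sum_diff// mul_diff_sum.
have -> : (A + C) * (A - C) = A * A + (b ^+ 2)%:C *: 1.
  rewrite mul_sum_diff//; congr (_ + _).
  rewrite /C -scalerAl mul1r scalerA -scaleNr.
  by rewrite mulrACA -expr2 sqr_i mulN1r opprK -rcM.
have b2 : 0 < b ^+ 2 by rewrite exprn_even_gt0.
have sA : sa A by apply: sa_sub => //; apply: sa_scale; exact: sa_1.
apply: (coercive_inv b2).
  by apply: sa_add; [exact: sa_mul|apply: sa_scale; exact: sa_1].
by move=> x; rewrite !qfE qf_mulr// lerDr sqr_ge0.
Qed.

(** For [r < a] the operator [T - r] is coercive with constant [a - r], so [r] is not in the
    spectrum. *)
Lemma Sp_ge T a r : sa T -> (forall x, a * nr x ^+ 2 <= qf T x) ->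
  Sp T r%:C -> a <= r.
Proof.
move=> sT Ta /SpE rT; rewrite leNgt; apply/negP => ra; apply: rT.
rewrite -inv_opN opprB.
have ar : 0 < a - r by rewrite subr_gt0.
apply: (coercive_inv ar); first by apply: sa_sub => //; apply: sa_scale; exact: sa_1.
by move=> x; rewrite !qfE; have := Ta x; lra.
Qed.

Lemma SpN T (z : R[i]) : Sp (- T) (- z) <-> Sp T z.
Proof.
by rewrite !SpE scaleNr -opprD inv_opN.
Qed.

Lemma Sp_le T b r : sa T -> (forall x, qf T x <= b * nr x ^+ 2) ->
  Sp T r%:C -> r <= b.
Proof.
move=> sT Tb /SpN; rewrite -rmorphN -lerN2; apply: Sp_ge; first exact: sa_opp.
by move=> x; rewrite !qfE mulNr lerN2.
Qed.

(* Nonpositivity of [qf P] at [x + P x / L]. *)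
Lemma neg_sqr_le P (L : R) x : 0 < L -> sa P -> (forall x, qf P x <= 0) ->
  nle P L -> nr (P x) ^+ 2 <= L * - qf P x.
Proof.
move=> L0 sP P0 PL; have := P0 (x + L^-1%:C *: P x).
rewrite /qf bopD bopZ !(rinDl, rinDr, rinZl, rinZr) (sP (P x)) -nr_sqr.
rewrite -/(qf P x).
have := nle_qf (P x) PL; rewrite ler_norml {1}/qf (sP (P x)) => /andP[h _].
rewrite -(pmulr_rle0 _ L0) !mulrDr !(mulrA L) mulfV ?gt_eqF// !mul1r.
have : L^-1 * (- (L * nr (P x) ^+ 2)) <= L^-1 * rin (P x) (P (P x)).
  by rewrite ler_pM2l ?invr_gt0.
rewrite mulrN mulrA mulVf ?gt_eqF// mul1r; lra.
Qed.

(** Let [m] be the infimum of the form on the unit sphere and [P = m - T <= 0]. An inverse of [P]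
    bounded by [K] gives [|x| <= K |P x|], while [neg_sqr_le] gives [|P x|^2 <= - L <P x, x>]. The
    form of [T] would then be at least [m + (K^2 L)^-1] on the sphere. *)
Lemma Sp_inf T : sa T ->
  exists2 m, forall x, m * nr x ^+ 2 <= qf T x & Sp T m%:C.
Proof.
move=> sT; pose E := [set qf T x | x in [set x | nr x = 1]].
have [M M0 TM] := bop_bound T.
have scal x : x != 0 -> nr ((nr x)^-1%:C *: x) = 1.
  by move=> x0; rewrite nrZr ger0_norm ?invr_ge0 ?nr_ge0// mulVf// nr_eq0.
have E0 : E !=set0 by have [x /scal x0] := H_nt; eexists; eexists; [exact: x0|].
have lbE : has_lbound E.
  exists (- M) => _ [x /= x1 <-]; have := nle_qf x TM.
  by rewrite x1 expr1n mulr1 ler_norml => /andP[].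
pose m := inf E; have mT x : m * nr x ^+ 2 <= qf T x.
  have [->|x0] := eqVneq x 0; first by rewrite nr0 expr0n mulr0 /qf raddf0 -nr_sqr nr0 expr0n.
  have : m <= qf T ((nr x)^-1%:C *: x) by apply: ge_inf => //; exists ((nr x)^-1%:C *: x) => //; exact: scal.
  rewrite /qf linearZ /= rinZl rinZr mulrA -expr2 mulrC exprVn ler_pdivlMr//.
  by rewrite exprn_gt0// nr_gt0.
exists m => //; apply/SpE => -[S [S1 S2]].
pose P := m%:C%:A - T.
have [K K0 SK] := bop_bound S; have [L L0 PL] := bop_bound P.
have sP : sa P by apply: sa_sub => //; apply: sa_scale; exact: sa_1.
have P0 x : qf P x <= 0 by rewrite !qfE subr_le0.
have Px x := neg_sqr_le x L0 sP P0 PL.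
pose d := (K ^+ 2 * L)^-1.
have KL0 : 0 < K ^+ 2 * L by rewrite mulr_gt0// exprn_gt0.
have d0 : 0 < d by rewrite invr_gt0.
have Td x : (m + d) * nr x ^+ 2 <= qf T x.
  have xS : nr x <= K * nr (P x) by rewrite -{1}[x]/((1 : B) x) -S1; exact: SK.
  have xS2 : nr x ^+ 2 <= K ^+ 2 * nr (P x) ^+ 2.
    by rewrite -exprMn ler_pXn2r ?nnegrE ?nr_ge0// mulr_ge0 ?nr_ge0 ?ltW.
  have : d * nr x ^+ 2 <= - qf P x.
    rewrite -(ler_pM2l KL0) mulrA mulfV ?gt_eqF// mul1r; apply: le_trans xS2 _.
    by rewrite -[K ^+ 2 * L * _]mulrA ler_pM2l ?exprn_gt0.
  by rewrite !qfE; lra.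
have : m + d <= m.
  by apply: lb_le_inf => // _ [x /= x1 <-]; have := Td x; rewrite x1 expr1n mulr1.
lra.
Qed.

Lemma Sp_sup T : sa T ->
  exists2 m, forall x, qf T x <= m * nr x ^+ 2 & Sp T m%:C.
Proof.
move=> sT; have [m mT mS] := Sp_inf (sa_opp sT); exists (- m).
  by move=> x; have := mT x; rewrite qfE mulNr; lra.
by apply/SpN; rewrite rmorphN opprK.
Qed.

(* The infimum [m] of the numerical range of [p(T)] lies in its spectrum;
factoring [p - m] over the complex numbers gives a root of it in [Sp T]. *)
Lemma evalp_ge0 T (p : {poly R}) : sa T ->
  (forall r, Sp T r%:C -> 0 <= p.[r]) -> forall x, 0 <= qf (evalp p T) x.
Proof.
move=> sT pT x; have [m mp mS] := Sp_inf (sa_evalp p sT).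
suff m0 : 0 <= m by rewrite (le_trans _ (mp x))// mulr_ge0// sqr_ge0.
pose pm := p - m%:P.
have pmE : evalp pm T = evalp p T - m%:C%:A by rewrite evalpB evalpC.
have {mS} pm_inv : ~ inv_op (evalp pm T).
  move=> hi; apply: (proj1 (SpE _ _) mS); by rewrite -inv_opN opprB -pmE.
pose pc := map_poly (real_complex R) pm.
(* A constant [p = m] has no root to find; its sign is read at any point of the spectrum, nonempty
   by [Sp_inf]. *)
have [pm0|pm0] := eqVneq pm 0.
  have [r _ /pT] := Sp_inf sT.
  by rewrite (_ : p = m%:P) ?hornerC//; apply/eqP; rewrite -subr_eq0 -/pm pm0.
have [rs pcE] := closed_field_poly_normal pc.
have : ~ forall z : R[i], z \in rs -> ~ Sp T z.
  move=> hz; apply: pm_inv; rewrite /evalp -/pc pcE linearZ /= rmorph_prod /= mulr_algl.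
  apply: inv_op_scale; first by rewrite lead_coef_eq0 map_poly_eq0.
  rewrite big_seq; apply: (big_ind (fun S : B => inv_op S)).
  - by exists 1; rewrite mulr1.
  - exact: inv_op_mul.
  move=> z /hz /SpE /contrapT.
  rewrite rmorphB /= horner_algX horner_algC => hi.
  by rewrite -inv_opN opprB.
move=> /existsNP[z /not_implyP[zrs /contrapT zT]].
(* The complex root lies in the spectrum, hence is real, and [m] is the value of [p] there. *)
have zr := Sp_real sT zT; rewrite zr in zT.
have : root pc z by rewrite pcE rootZ ?lead_coef_eq0 ?map_poly_eq0// root_prod_XsubC.
rewrite zr fmorph_root /root !hornerE subr_eq0 => /eqP <-.
exact: pT.
Qed.

End Spectrum.

(** * Polynomial approximation *)

Section Weierstrass.
Variable R : realType.
Implicit Types (f : R -> R) (g h : nat -> R) (a b x y e : R).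

Lemma itv_unif_continuous f a b e : {within `[a, b], continuous f} -> 0 < e ->
  exists2 d, 0 < d & forall x y, a <= x <= b -> a <= y <= b ->
    `|x - y| < d -> `|f x - f y| <= e.
Proof.
move=> cf e0.
have /compact_near_coveringP/near_covering_withinP ncov := @segment_compact R a b.
pose P d x := forall y, a <= y <= b -> `|x - y| < d -> `|f x - f y| <= e.
have : \forall d \near 0^'+, `[a, b] `<=` P d.
  apply: ncov => x abx.
  have /subspace_continuousP/(_ _ abx)/cvgrPdist_le/(_ _ (divr_gt0 e0 (ltr0Sn _ 1))) := cf.
  rewrite near_withinE => -[r /= r0 rx].
  have r2 : 0 < r / 2 by rewrite divr_gt0.
  exists (ball x (r / 2), [set d | d < r / 2]) => /=.
    by split; [exact: nbhsx_ballx|exact: nbhs_right_lt].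
  move=> [x' d] /= [xx' dr] abx' y aby x'y.
  rewrite /ball /= in xx'.
  have h1 : `|f x - f x'| <= e / 2.
    by apply: rx => //=; rewrite (lt_le_trans xx')//; lra.
  have h2 : `|f x - f y| <= e / 2.
    have xy : `|x - y| < r.
      rewrite -(subrKA x') (le_lt_trans (ler_normD _ _))//; lra.
    exact: (rx y xy aby).
  rewrite -(subrKA (f x)) (le_trans (ler_normD _ _))// (distrC _ (f x)); lra.
move=> [d /= d0 dP]; exists (d / 2); first by rewrite divr_gt0.
move=> x y abx aby; apply: (dP (d / 2)) => //=; rewrite ?in_itv//=.
  by rewrite sub0r normrN gtr0_norm ?divr_gt0//; lra.
by rewrite divr_gt0.
Qed.

(* The Bernstein operator of degree [n] applied to a function with values [g k]
at [k / n], defined through de Casteljau's recursion. *)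
Fixpoint bernstein n g : {poly R} :=
  if n is m.+1 then 'X * bernstein m (g \o succn) + (1 - 'X) * bernstein m g
  else (g 0%N)%:P.

Lemma bernstein_le n g h x : 0 <= x <= 1 ->
  (forall k, (k <= n)%N -> g k <= h k) ->
  (bernstein n g).[x] <= (bernstein n h).[x].
Proof.
move=> /andP[x0 x1]; elim: n g h => [|n IH] g h gh; first by rewrite !hornerC gh.
by rewrite /= !hornerE lerD ?ler_wpM2l ?subr_ge0 ?IH// => k kn; apply: gh; lia.
Qed.

(** The mean of [c + d (k - e)^2] for a binomial [k]: variance [n x (1 - x)] plus squared bias.
    Leaving [e] free lets the induction absorb the shift of [k] as [e - 1]. *)
Lemma bernstein_sqr n (c d e x : R) :
  (bernstein n (fun k => c + d * (k%:R - e) ^+ 2)).[x] =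
  c + d * (n%:R * x * (1 - x) + (n%:R * x - e) ^+ 2).
Proof.
elim: n e => [|n IH] e; first by rewrite /= hornerC; ring.
rewrite /= !hornerE IH.
have -> : (fun k => c + d * (k%:R - e) ^+ 2) \o succn =
          (fun k => c + d * (k%:R - (e - 1)) ^+ 2).
  by apply/funext => k /=; rewrite -addn1 natrD opprB addrA addrAC.
by rewrite IH -[n.+1]addn1 natrD; ring.
Qed.

Lemma itv_bounded f a b : {within `[a, b], continuous f} ->
  exists2 M, 0 <= M & forall x, a <= x <= b -> `|f x| <= M.
Proof.
move=> cf; have [ab|ba] := leP a b; last by exists 0 => // x; lra.
have [c _ cM] := EVT_max ab cf; have [c' _ cM'] := EVT_min ab cf.
exists (`|f c| + `|f c'|); first by rewrite addr_ge0.
move=> x abx; have := cM x; have := cM' x; rewrite !in_itv => /(_ abx) h1 /(_ abx) h2.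
have := ler_norm (f c); have := ler_norm (- f c'); rewrite normrN.
have := normr_ge0 (f c); have := normr_ge0 (f c').
rewrite ler_norml; lra.
Qed.

(** Around each [x], uniform continuity and boundedness enclose [f] between two parabolas centred at
    [x]. The Bernstein operator is monotone and explicit on parabolas, which bounds its error at
    [x]. *)
Lemma weierstrass f a b e : {within `[a, b], continuous f} -> 0 < e ->
  exists p : {poly R}, forall x, a <= x <= b -> `|p.[x] - f x| <= e.
Proof.
move=> cf e0; have [ab|ba] := ltP a b; last first.
  exists (f a)%:P => x /andP[ax xb]; have -> : x = a by lra.
  by rewrite hornerC subrr normr0 ltW.
have e2 : 0 < e / 2 by lra.
have [d d0 fd] := itv_unif_continuous cf e2.
have [M M0 fM] := itv_bounded cf.
(* Chosen so that [2 * M <= K * (x - y) ^+ 2] as soon as [d <= |x - y|]. *)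
pose K := 2 * M / d ^+ 2.
have d2 : 0 < d ^+ 2 by rewrite exprn_gt0.
have K0 : 0 <= K by rewrite divr_ge0 ?mulr_ge0//; exact: ltW.
(* Bounds the oscillation of [f] by what [bernstein_sqr] controls. *)
have fK x y : a <= x <= b -> a <= y <= b -> `|f x - f y| <= e / 2 + K * (x - y) ^+ 2.
  move=> abx aby; have [xyd|dxy] := ltP `|x - y| d.
    by rewrite (le_trans (fd _ _ abx aby xyd))// lerDl mulr_ge0// sqr_ge0.
  rewrite (le_trans (ler_normB _ _))// (le_trans (lerD (fM _ abx) (fM _ aby)))//.
  have dxy2 : d ^+ 2 <= (x - y) ^+ 2.
    rewrite -[leRHS]real_normK ?num_real// ler_pXn2r ?nnegrE//; exact: ltW.
  have : M + M <= K * (x - y) ^+ 2.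
    rewrite (_ : M + M = K * d ^+ 2) ?ler_wpM2l//.
    by rewrite /K divfK ?gt_eqF//; ring.
  lra.
(* [K] after rescaling [[a, b]] to [[0, 1]]; the variance then contributes
   [L / N * (u * (1 - u))]. *)
pose L := K * (b - a) ^+ 2.
have [N N0 LN] : exists2 N, 0 < N%:R :> R & L / N%:R <= e / 2.
  exists (Num.trunc (L / (e / 2))).+1 => //.
  by rewrite ler_pdivrMr// mulrC -ler_pdivrMr// ltW// truncnS_gt.
have ba0 : 0 < b - a by lra.
pose g k := f (a + (b - a) * (k%:R / N%:R)).
exists (bernstein N g \Po ((b - a)^-1 *: ('X - a%:P))) => x /[dup] abx /andP[ax xb].
rewrite horner_comp !hornerE.
set u := (b - a)^-1 * (x - a).
have xE : x = a + (b - a) * u by rewrite /u mulrA mulfV ?gt_eqF//; ring.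
have u01 : 0 <= u <= 1.
  apply/andP; split; first by rewrite -(pmulr_rge0 _ ba0); lra.
  by rewrite -(ler_pM2l ba0) mulr1; lra.
pose c := L / N%:R ^+ 2.
have gx k : (k <= N)%N -> `|g k - f x| <= e / 2 + c * (k%:R - N%:R * u) ^+ 2.
  move=> kN; have kN1 : 0 <= (k%:R : R) / N%:R <= 1.
    by rewrite divr_ge0//= ler_pdivrMr// mul1r ler_nat.
  apply: le_trans (fK _ _ _ abx) _; first by apply/andP; split; nra.
  rewrite lerD2l {1}xE le_eqVlt; apply/orP; left; apply/eqP.
  by rewrite /c /L; field; rewrite gt_eqF.
have vE : c * (N%:R * u * (1 - u) + (N%:R * u - N%:R * u) ^+ 2) <= e / 2.
  apply: le_trans LN.
  have -> : c * (N%:R * u * (1 - u) + (N%:R * u - N%:R * u) ^+ 2) = L / N%:R * (u * (1 - u)).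
    by rewrite /c; field; rewrite gt_eqF.
  have : 0 <= L / N%:R by rewrite divr_ge0// /L mulr_ge0// sqr_ge0.
  have : u * (1 - u) <= 1 by nra.
  nra.
rewrite ler_distl; apply/andP; split.
  have : (bernstein N (fun k => (f x - e / 2) + (- c) * (k%:R - N%:R * u) ^+ 2)).[u] <= (bernstein N g).[u].
    by apply: bernstein_le => // k /gx; rewrite ler_norml; lra.
  rewrite bernstein_sqr; lra.
have : (bernstein N g).[u] <= (bernstein N (fun k => (f x + e / 2) + c * (k%:R - N%:R * u) ^+ 2)).[u].
  by apply: bernstein_le => // k /gx; rewrite ler_norml; lra.
rewrite bernstein_sqr; lra.
Qed.

End Weierstrass.

(** * Continuous functional calculus *)

Lemma invS_small (R : realType) (e : R) : 0 < e ->
  exists N, forall n, (N <= n)%N -> n.+1%:R^-1 <= e.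
Proof.
move=> e0; exists (Num.trunc e^-1) => n Nn.
rewrite -[e]invrK lef_pV2 ?posrE ?invr_gt0//.
by rewrite (le_trans (ltW (truncnS_gt _)))// ler_nat.
Qed.

Section FunctionalCalculus.
Variables (R : realType) (H : hilbertType R) (H_nt : exists x : H, x != 0).
Local Notation B := (bop H_nt).
Implicit Types (S T U : B) (f g : R -> R) (p : {poly R}) (a b c e : R).

(** One polynomial per precision instead of the sequence of [is_cfc]: algebraic rules then need no
    choice of sequences. [cfc_limP] makes the link. *)
Definition cfc_lim f T S := forall e, 0 < e ->
  exists2 p : {poly R}, forall r, Sp T r%:C -> `|p.[r] - f r| <= e &
    nle (S - evalp p T) e.

(** Stands for a spectrum inside [[a, b]], in a form that is easy to carry through congruences and
    means. *)
Definition sa_within a b T := [/\ sa T, forall x, a * nr x ^+ 2 <= qf T x &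
  forall x, qf T x <= b * nr x ^+ 2].

Lemma sa_within_Sp a b T r : sa_within a b T -> Sp T r%:C -> a <= r <= b.
Proof.
by move=> [sT Ta Tb] rT; rewrite (Sp_ge sT Ta rT) (Sp_le sT Tb rT).
Qed.

Lemma sa_within_nle a b T : sa_within a b T -> nle T (`|a| + `|b|).
Proof.
move=> [sT Ta Tb]; apply: sa_norm_le => // x.
have n2 : 0 <= nr x ^+ 2 by exact: sqr_ge0.
have := Ta x; have := Tb x; have := ler_norm b; have := ler_norm (- a).
rewrite normrN ler_norml; have := normr_ge0 a; have := normr_ge0 b; nra.
Qed.

Lemma evalp_norm T p c : 0 <= c -> sa T ->
  (forall r, Sp T r%:C -> `|p.[r]| <= c) -> nle (evalp p T) c.
Proof.
move=> c0 sT pc; apply: sa_norm_le => //; first exact: sa_evalp.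
move=> x; rewrite ler_norml; apply/andP; split.
  have : 0 <= qf (evalp (p + c%:P) T) x.
    by apply: evalp_ge0 => // r /pc; rewrite !hornerE ler_norml; lra.
  by rewrite evalpD evalpC !qfE; lra.
have : 0 <= qf (evalp (c%:P - p) T) x.
  by apply: evalp_ge0 => // r /pc; rewrite !hornerE ler_norml; lra.
by rewrite evalpB evalpC !qfE; lra.
Qed.

Lemma cfc_lim_poly p T : cfc_lim (horner p) T (evalp p T).
Proof.
move=> e e0; exists p; first by move=> r _; rewrite subrr normr0 ltW.
by rewrite subrr => x; rewrite bop_0E nr0 mulr_ge0 ?nr_ge0 ?ltW.
Qed.

Lemma eq_cfc_lim f g T S : (forall r, Sp T r%:C -> f r = g r) ->
  cfc_lim f T S -> cfc_lim g T S.
Proof.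
move=> fg fS e e0; have [p fp pS] := fS e e0; exists p => // r rT.
by rewrite -fg// fp.
Qed.

Lemma cfc_lim_ge0 f T S : sa T -> (forall r, Sp T r%:C -> 0 <= f r) ->
  cfc_lim f T S -> forall x, 0 <= qf S x.
Proof.
move=> sT f0 fS x; rewrite -oppr_le0; apply/ler_addgt0Pl => d d0; rewrite addr0.
have n1 : 0 < 2 * (nr x ^+ 2 + 1) by rewrite mulr_gt0// ltr_wpDl// sqr_ge0.
pose e := d / (2 * (nr x ^+ 2 + 1)).
have e0 : 0 < e by rewrite divr_gt0.
have [p fp pS] := fS e e0.
have : 0 <= qf (evalp (p + e%:P) T) x.
  apply: evalp_ge0 => // r rT; rewrite !hornerE.
  by have := fp r rT; have := f0 r rT; rewrite ler_norml; lra.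
have := nle_qf x pS; rewrite evalpD evalpC !qfE ler_norml => /andP[h _] h'.
have -> : d = e * (2 * (nr x ^+ 2 + 1)) by rewrite divfK// gt_eqF.
have : 0 <= nr x ^+ 2 by exact: sqr_ge0.
nra.
Qed.

Lemma cfc_lim_sub f g T S S' : cfc_lim f T S -> cfc_lim g T S' ->
  cfc_lim (fun x => f x - g x) T (S - S').
Proof.
move=> fS gS' e e0; have e2 : 0 < e / 2 by rewrite divr_gt0.
have [p fp pS] := fS _ e2; have [q gq qS'] := gS' _ e2.
exists (p - q).
  move=> r rT; rewrite !hornerE; have := fp r rT; have := gq r rT.
  by rewrite !ler_norml; lra.
have -> : S - S' - evalp (p - q) T = (S - evalp p T) - (S' - evalp q T).
  by rewrite evalpB opprD addrACA -opprD.
rewrite [e]splitr; exact: nle_sub.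
Qed.

Lemma cfc_lim_add f g T S S' : cfc_lim f T S -> cfc_lim g T S' ->
  cfc_lim (fun x => f x + g x) T (S + S').
Proof.
move=> fS gS'; have gN := cfc_lim_sub (@cfc_lim_poly 0 T) gS'.
have := cfc_lim_sub fS gN; rewrite /evalp !rmorph0 sub0r opprK.
by apply: eq_cfc_lim => r _; rewrite horner0 sub0r opprK.
Qed.

Lemma cfc_lim_mul f g T S S' (F G : R) :
  (forall r, Sp T r%:C -> `|f r| <= F) -> (forall r, Sp T r%:C -> `|g r| <= G) ->
  cfc_lim f T S -> cfc_lim g T S' -> cfc_lim (fun x => f x * g x) T (S * S').
Proof.
move=> fF gG fS gS' e e0.
have [M M0 SM] := bop_bound S; have [M' M0' SM'] := bop_bound S'.
pose k := `|F| + `|G| + M + M' + 1.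
have F0 := normr_ge0 F; have G0 := normr_ge0 G.
have k0 : 0 < k by rewrite /k; lra.
(* [d <= 1] makes [d ^+ 2 <= d], so both product errors are at most [d * k <= e]. *)
pose d := Num.min 1 (e / k).
have d0 : 0 < d by rewrite lt_min ltr01 divr_gt0.
have d1 : d <= 1 by rewrite ge_min lexx.
have dk : d * k <= e by rewrite -ler_pdivlMr// ge_min lexx orbT.
have [p fp pS] := fS d d0; have [q gq qS'] := gS' d d0.
exists (p * q).
  move=> r rT; rewrite !hornerE.
  have -> : p.[r] * q.[r] - f r * g r =
    (p.[r] - f r) * (q.[r] - g r) + (p.[r] - f r) * g r + f r * (q.[r] - g r) by ring.
  have h1 := fp r rT; have h2 := gq r rT.
  have h3 : `|g r| <= `|G| by rewrite (le_trans (gG r rT))// ler_norm.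
  have h4 : `|f r| <= `|F| by rewrite (le_trans (fF r rT))// ler_norm.
  apply: le_trans dk.
  rewrite (le_trans (ler_normD _ _))// (le_trans (lerD (ler_normD _ _) (lexx _)))//.
  rewrite !normrM.
  apply: (@le_trans _ _ (d * 1 + d * `|G| + `|F| * d)).
    by rewrite !lerD// ler_pM// (le_trans h2).
  rewrite /k; nra.
have -> : S * S' - evalp (p * q) T =
   (S - evalp p T) * S' + evalp p T * (S' - evalp q T).
  by rewrite evalpM mulrBl mulrBr subrKA.
have pM : nle (evalp p T) (M + d).
  have -> : evalp p T = S - (S - evalp p T) by rewrite opprB addrC subrK.
  exact: nle_sub.
apply: (@nle_weak _ _ _ (d * M' + (M + d) * d)); first by move: dk; rewrite /k; nra.
by apply: nle_add; apply: nle_mul => //; lra.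
Qed.

Lemma cfc_lim_sa f T S : sa T -> cfc_lim f T S -> sa S.
Proof.
move=> sT fS; apply: sa_lim => e /fS[p _ pS].
by exists (evalp p T) => //; exact: sa_evalp.
Qed.

Lemma cfc_lim_comm f T S U : U * T = T * U -> cfc_lim f T S -> U * S = S * U.
Proof.
move=> UT fS; have [M M0 UM] := bop_bound U.
apply/val_inj/nle_small => d d0.
have k0 : 0 < 2 * M by rewrite mulr_gt0.
have [p fp pS] := fS _ (divr_gt0 d0 k0).
set e := d / _ in fp pS.
(* [U] commutes with every polynomial in [T], so only the approximation error enters the
   commutator. *)
have -> : bfun (U * S) - bfun (S * U) = bfun (U * (S - evalp p T) - (S - evalp p T) * U).
  by rewrite mulrBr mulrBl (comm_evalp p UT) opprB subrKA.
have -> : d = M * e + e * M by rewrite /e; field; rewrite gt_eqF.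
have e0 : 0 <= e by rewrite divr_ge0 ?ltW.
by apply: nle_sub; apply: nle_mul => //; exact: ltW.
Qed.

Lemma cfc_lim_le f g T S S' : sa T -> (forall r, Sp T r%:C -> f r <= g r) ->
  cfc_lim f T S -> cfc_lim g T S' -> ple S S'.
Proof.
move=> sT fg fS gS' x; rewrite -subr_ge0 -qf_sub.
apply: (cfc_lim_ge0 sT) (cfc_lim_sub gS' fS) _ => r rT.
by rewrite subr_ge0 fg.
Qed.

(** Contractivity of the calculus. It yields uniqueness when [f = g], continuity in the exponent of
    a power, and the error of a polynomial approximation. *)
Lemma cfc_lim_norm f g T S S' c : 0 <= c -> sa T ->
  (forall r, Sp T r%:C -> `|f r - g r| <= c) ->
  cfc_lim f T S -> cfc_lim g T S' -> nle (S - S') c.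
Proof.
move=> c0 sT fg fS gS' x; apply/ler_addgt0Pl => d d0.
have k0 : 0 < 2 * (nr x + 1) by rewrite mulr_gt0// ltr_wpDl// nr_ge0.
have [p fp pS] := cfc_lim_sub fS gS' (divr_gt0 d0 k0).
set e := d / _ in fp pS.
have e0 : 0 < e by rewrite divr_gt0.
have pb : nle (evalp p T) (c + e).
  apply: evalp_norm => //; first by lra.
  move=> r rT; have := fp r rT; have := fg r rT; rewrite !ler_norml; lra.
have -> : S - S' = (S - S' - evalp p T) + evalp p T by rewrite subrK.
rewrite (le_trans (nle_add pS pb x))//.
have -> : d = e * (2 * (nr x + 1)) by rewrite divfK// gt_eqF.
have := nr_ge0 x; nra.
Qed.

Lemma cfc_lim_exists f a b T : {within `[a, b], continuous f} ->
  sa_within a b T -> exists S, cfc_lim f T S.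
Proof.
move=> cf Tab; have [sT _ _] := Tab.
have n0 n : 0 < n.+1%:R^-1 :> R by rewrite invr_gt0.
have /choice[p pf] n := weierstrass cf (n0 n).
have pf' n r : Sp T r%:C -> `|(p n).[r] - f r| <= n.+1%:R^-1.
  by move=> rT; apply: pf; exact: (sa_within_Sp Tab).
have cauchy e : 0 < e -> exists N, forall m n, (N <= m)%N -> (N <= n)%N ->
    nle (evalp (p m) T - evalp (p n) T) e.
  move=> e0; have [N Ne] := invS_small (divr_gt0 e0 (ltr0Sn _ 1) : 0 < e / 2).
  exists N => m n Nm Nn; rewrite -evalpB; apply: evalp_norm => //; first exact: ltW.
  move=> r rT; have := pf' m r rT; have := pf' n r rT.
  have := Ne m Nm; have := Ne n Nn; rewrite !hornerE !ler_norml.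
  by move: n.+1%:R^-1 m.+1%:R^-1 => u v; lra.
have [S TS] := bop_complete cauchy.
exists S => e e0; have [N Ne] := invS_small e0; have [N' Se] := TS e e0.
exists (p (maxn N N')); last exact/Se/leq_maxr.
by move=> r rT; rewrite (le_trans (pf' _ _ rT))// Ne// leq_maxl.
Qed.

Lemma cfc_limP f T S : sa T -> cfc_lim f T S -> cfc f T = S.
Proof.
move=> sT fS.
have unif (p : nat -> {poly R}) :
    {uniform [set x | Sp T x%:C], (fun n => horner (p n)) @ \oo --> f} <->
    forall e, 0 < e -> exists N, forall n, (N <= n)%N ->
      forall r, Sp T r%:C -> `|(p n).[r] - f r| <= e.
  split=> [pf e e0|pf P].
    have /pf[N _ NP] : nbhs (f : {uniform` [set x | Sp T x%:C] -> R})
        [set h | forall r, Sp T r%:C -> `|h r - f r| <= e].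
      apply/uniform_nbhs; exists [set xy | ball xy.1 e xy.2]; split.
        by rewrite -entourage_ballE; exists e.
      move=> h /= fh r rT; have := fh r rT; rewrite /ball/= distrC; exact: ltW.
    by exists N => n Nn; exact: NP.
  move=> /uniform_nbhs[E []]; rewrite -entourage_ballE => -[e /= e0 eE] EP.
  have [N pN] := pf (e / 2) (divr_gt0 e0 (ltr0Sn _ 1)).
  exists N => // n Nn; apply: EP => r rT; apply: eE; rewrite /ball/= distrC.
  by rewrite (le_lt_trans (pN n Nn r rT))//; lra.
have uniq (S' : H -> H) : is_cfc f T S' -> S' = S.
  move=> [p /unif pf pS']; apply: nle_small => e e0.
  have e3 : 0 < e / 4 by rewrite divr_gt0.
  have [N pN] := pf _ e3; have [N' _ pN'] := pS' _ e3.
  have [q fq qS] := fS _ e3.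
  pose n := maxn N N'.
  have h1 : nle (S' - bfun (evalp (p n) T)) (e / 4).
    by rewrite -poly_op_evalp -opnorm_leE; apply: pN'; exact: leq_maxr.
  have h2 : nle (evalp q T - evalp (p n) T) (e / 4 + e / 4).
    rewrite -evalpB; apply: evalp_norm => //; first by lra.
    move=> r rT; have := fq r rT; have := pN n (leq_maxl _ _) r rT.
    by rewrite !hornerE !ler_norml; lra.
  move=> x; have := h1 x; have := h2 x; have := qS x.
  rewrite !bop_subE.
  (* [S'] and [S] come with different polynomials, compared through their values on the spectrum;
     the three errors are [e / 4], [e / 4] and [e / 2]. *)
  have -> : (S' - bfun S) x = (S' - bfun (evalp (p n) T)) x -
     (S x - evalp q T x) - (evalp q T x - evalp (p n) T x).
    rewrite -addrA -opprD subrKA opprB.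
    exact: (esym (subrKA _ _ _)).
  have : e / 4 * nr x + e / 4 * nr x + (e / 4 + e / 4) * nr x = e * nr x by field.
  move=> <- h1' h2' h3'; rewrite (le_trans (nrB _ _))// lerD//.
  by rewrite (le_trans (nrB _ _))// lerD.
rewrite /cfc; apply: xget_unique; last exact: uniq.
have /choice[p pP] n : exists p : {poly R},
    (forall r, Sp T r%:C -> `|p.[r] - f r| <= n.+1%:R^-1) /\
    nle (S - evalp p T) n.+1%:R^-1.
  by have [|p pf pS] := fS n.+1%:R^-1; [rewrite invr_gt0|exists p].
exists p.
  apply/unif => e /invS_small[N Ne]; exists N => n Nn r rT.
  by rewrite (le_trans (proj1 (pP n) r rT))// Ne.
move=> e /invS_small[N Ne]; exists N => // n /= Nn.
rewrite poly_op_evalp; apply/opnorm_leE; exact: nle_weak (Ne n Nn) (proj2 (pP n)).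
Qed.

End FunctionalCalculus.

(** * Powers of positive operators *)

Section RealPowers.
Variable R : realType.
Implicit Types (a b c s t x : R).

Lemma powRE x t : 0 < x -> x `^ t = expR (t * ln x).
Proof. by move=> x0; rewrite /powR gt_eqF. Qed.

Lemma within_powR a b t : 0 < a ->
  {within `[a, b], continuous (fun x => x `^ t)}.
Proof.
move=> a0; apply: derivable_within_continuous => x; rewrite in_itv => /andP[ax _].
by apply: derivable_powR; rewrite in_itv /= andbT (lt_le_trans a0).
Qed.

(** With [E = x^t] and [L = ln x], the bound [1 + z <= expR z] gives [E (1 + (1 - t) L) <= x] and
    [E (1 - t L) <= 1]. Weighted by [t] and [1 - t], the terms in [L] cancel. *)
Lemma powR_le_arith x t : 0 < x -> 0 <= t <= 1 -> x `^ t <= 1 - t + t * x.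
Proof.
move=> x0 /andP[t0 t1]; rewrite powRE//; set L := ln x.
have xE : x = expR (t * L) * expR ((1 - t) * L).
  by rewrite -expRD -mulrDl addrCA subrr addr0 mul1r lnK.
have E0 : 0 < expR (t * L) by exact: expR_gt0.
have h1 : expR (t * L) * (1 + (1 - t) * L) <= x.
  by rewrite [leRHS]xE ler_pM2l// expR_ge1Dx.
have h2 : expR (t * L) * (1 + - (t * L)) <= 1.
  by rewrite -[leRHS](expR0 R) -(subrr (t * L)) expRD ler_pM2l// expR_ge1Dx.
move: (expR (t * L)) E0 h1 h2 => E E0 h1 h2.
have : t * (E * (1 + (1 - t) * L)) <= t * x by rewrite ler_wpM2l.
have : (1 - t) * (E * (1 + - (t * L))) <= (1 - t) * 1 by rewrite ler_wpM2l//; lra.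
by nra.
Qed.

Lemma expR_lip u v (L : R) : u <= L -> v <= L ->
  `|expR u - expR v| <= expR L * `|u - v|.
Proof.
wlog vu : u v / v <= u.
  move=> W uL vL; have [vu|/ltW uv] := leP v u; first exact: W.
  by rewrite distrC [`|u - v|]distrC W.
move=> uL vL; rewrite !ger0_norm ?subr_ge0 ?ler_expR//.
apply: (@le_trans _ _ (expR u * (u - v))); last first.
  by rewrite ler_wpM2r ?subr_ge0// ler_expR.
have -> : expR v = expR u * expR (v - u) by rewrite -expRD addrC subrK.
rewrite -{1}[expR u]mulr1 -mulrBr ler_pM2l ?expR_gt0//.
have := expR_ge1Dx (v - u); lra.
Qed.

(** Uniform in [x], so that it becomes a norm estimate for powers of an operator; the slope is
    controlled by the bound [L] on [|ln x|] over [[a, b]]. *)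
Lemma powR_lip a b : 0 < a -> exists2 K, 0 <= K &
  forall x s t, a <= x <= b -> 0 <= s <= 1 -> 0 <= t <= 1 ->
    `|x `^ s - x `^ t| <= K * `|s - t|.
Proof.
move=> a0; pose L := `|ln a| + `|ln b|.
exists (expR L * L); first by rewrite mulr_ge0 ?expR_ge0// addr_ge0.
move=> x s t /andP[ax xb] s01 t01.
have x0 : 0 < x by rewrite (lt_le_trans a0).
have lx : `|ln x| <= L.
  have : ln a <= ln x by rewrite ler_ln.
  have : ln x <= ln b by rewrite ler_ln// posrE (lt_le_trans x0).
  have := ler_norm (ln b); have := ler_norm (- ln a); rewrite normrN.
  have := normr_ge0 (ln a); have := normr_ge0 (ln b).
  rewrite /L ler_norml; lra.
have le1 r : 0 <= r <= 1 -> r * ln x <= L.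
  move=> /andP[r0 r1]; rewrite (le_trans (ler_norm _))// normrM ger0_norm//.
  by rewrite (le_trans _ lx)// ler_piMl.
rewrite !powRE// (le_trans (expR_lip (le1 _ s01) (le1 _ t01)))//.
rewrite -mulrBl normrM -mulrA ler_pM2l ?expR_gt0// mulrC ler_wpM2r//.
Qed.

End RealPowers.

Section Powers.
Variables (R : realType) (H : hilbertType R) (H_nt : exists x : H, x != 0).
Local Notation B := (bop H_nt).
Implicit Types (S T U : B) (f g : R -> R) (a b c s t r : R).

Definition fc f T : B := xget 0 [set S | cfc_lim f T S].

Lemma fc_eq f T S : sa T -> cfc_lim f T S -> fc f T = S.
Proof.
move=> sT fS; apply: xget_unique => // S' fS'.
apply/val_inj/nle_small => e e0.
apply: (cfc_lim_norm (ltW e0) sT _ fS' fS) => r _.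
by rewrite subrr normr0 ltW.
Qed.

Lemma Sp_within_le a b T : sa_within a b T -> a <= b.
Proof.
move=> Tab; have [sT _ _] := Tab; have [m _ mS] := Sp_inf sT.
by have /andP[+ +] := sa_within_Sp Tab mS; exact: le_trans.
Qed.

Lemma within_spectrum T : sa T ->
  exists m M, [/\ Sp T m%:C, Sp T M%:C & sa_within m M T].
Proof.
move=> sT; have [m mT mS] := Sp_inf sT; have [M MT MS] := Sp_sup sT.
by exists m, M; split=> //; split.
Qed.

Section Within.
Variables (a b : R) (T : B).
Hypothesis Tab : sa_within a b T.

Let sT : sa T. Proof. by case: Tab. Qed.

Section Continuous.
Variable f : R -> R.
Hypothesis cf : {within `[a, b], continuous f}.

Lemma fcP : cfc_lim f T (fc f T).
Proof.
by have [S fS] := cfc_lim_exists cf Tab; rewrite (fc_eq sT fS).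
Qed.

Lemma cfc_fc : cfc f T = fc f T.
Proof. by rewrite (cfc_limP sT fcP). Qed.

Lemma fc_ge c : (forall x, a <= x <= b -> c <= f x) ->
  forall x, c * nr x ^+ 2 <= qf (fc f T) x.
Proof.
move=> cfx x.
have := cfc_lim_le sT _ (@cfc_lim_poly _ _ _ c%:P T) fcP x.
rewrite evalpC !qfE; apply => r rT.
by rewrite hornerC cfx// (sa_within_Sp Tab rT).
Qed.

Lemma fc_le c : (forall x, a <= x <= b -> f x <= c) ->
  forall x, qf (fc f T) x <= c * nr x ^+ 2.
Proof.
move=> cfx x.
have := cfc_lim_le sT _ fcP (@cfc_lim_poly _ _ _ c%:P T) x.
rewrite evalpC !qfE; apply => r rT.
by rewrite hornerC cfx// (sa_within_Sp Tab rT).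
Qed.

Lemma fc_sa : sa (fc f T).
Proof. exact: cfc_lim_sa fcP. Qed.

Lemma fc_within c d : (forall x, a <= x <= b -> c <= f x <= d) ->
  sa_within c d (fc f T).
Proof.
move=> cfd; split; first exact: fc_sa.
  by apply: fc_ge => x /cfd/andP[].
by apply: fc_le => x /cfd/andP[].
Qed.

(** A positive continuous function has a positive minimum on [[a, b]], nonempty because the spectrum
    is. This makes [f(A)] and [f(B)] eligible for geometric means. *)
Lemma fc_pos : (forall x, a <= x <= b -> 0 < f x) ->
  exists c d, 0 < c /\ sa_within c d (fc f T).
Proof.
move=> f0; have ab := Sp_within_le Tab.
have [c cab cM] := EVT_min ab cf; have [d _ dM] := EVT_max ab cf.
exists (f c), (f d); split; first exact: f0.
by apply: fc_within => x abx; rewrite cM// dM.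
Qed.

End Continuous.

Lemma fc_norm f g c : {within `[a, b], continuous f} ->
  {within `[a, b], continuous g} -> 0 <= c ->
  (forall x, a <= x <= b -> `|f x - g x| <= c) -> nle (fc f T - fc g T) c.
Proof.
move=> cf cg c0 fg; apply: (cfc_lim_norm c0 sT _ (fcP cf) (fcP cg)) => r rT.
exact/fg/(sa_within_Sp Tab).
Qed.

Lemma fc_mul f g h : {within `[a, b], continuous f} ->
  {within `[a, b], continuous g} ->
  (forall x, a <= x <= b -> f x * g x = h x) -> fc f T * fc g T = fc h T.
Proof.
move=> cf cg fgh; apply/esym/(fc_eq sT).
have [M _ fM] := itv_bounded cf; have [M' _ gM] := itv_bounded cg.
have rab r : Sp T r%:C -> a <= r <= b by exact: sa_within_Sp.
apply: eq_cfc_lim (cfc_lim_mul _ _ (fcP cf) (fcP cg)) => r /rab; [exact: fgh| exact: fM| exact: gM].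
Qed.

End Within.

Definition pw T t : B := fc (fun x => x `^ t) T.

Section PositivePowers.
Variables (a b : R) (T : B).
Hypotheses (a0 : 0 < a) (Tab : sa_within a b T).

Let sT : sa T. Proof. by case: Tab. Qed.
Let x0 x : a <= x <= b -> 0 < x.
Proof. by move=> /andP[+ _]; exact: lt_le_trans. Qed.

Lemma op_pow_pw t : op_pow T t = pw T t.
Proof. exact: (cfc_fc Tab (@within_powR _ a b t a0)). Qed.

Lemma pwP t : cfc_lim (fun x => x `^ t) T (pw T t).
Proof. exact: (fcP Tab (@within_powR _ a b t a0)). Qed.

Lemma pw_sa t : sa (pw T t).
Proof. exact: (fc_sa Tab (@within_powR _ a b t a0)). Qed.

Lemma pwM s t : pw T s * pw T t = pw T (s + t).
Proof.
apply: (fc_mul Tab); [exact: within_powR|exact: within_powR|].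
by move=> x /x0 xp; rewrite powRD// (gt_eqF xp) implybT.
Qed.

Lemma pw_0 : pw T 0 = 1.
Proof.
apply: fc_eq => //.
have := @cfc_lim_poly _ _ _ 1%:P T; rewrite evalpC rmorph1 scale1r.
by apply: eq_cfc_lim => r _; rewrite hornerC powRr0.
Qed.

Lemma pw_1 : pw T 1 = T.
Proof.
apply: fc_eq => //.
have := @cfc_lim_poly _ _ _ 'X T; rewrite evalpX.
apply: eq_cfc_lim => r rT; rewrite hornerX powRr1// ltW// x0//.
exact: sa_within_Sp Tab rT.
Qed.

Lemma pwMN t : pw T t * pw T (- t) = 1.
Proof. by rewrite pwM subrr pw_0. Qed.

Lemma pwNM t : pw T (- t) * pw T t = 1.
Proof. by rewrite pwM addNr pw_0. Qed.

Lemma pw_half : pw T 2^-1 * pw T 2^-1 = T.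
Proof. by rewrite pwM (_ : 2^-1 + 2^-1 = 1) ?pw_1//; field. Qed.

Lemma pw_pos t : exists c d, 0 < c /\ sa_within c d (pw T t).
Proof.
by apply: (fc_pos Tab) => [|x /x0]; [exact: within_powR|exact: powR_gt0].
Qed.

Lemma pw_inv S : S * T = 1 -> pw T (- 1) = S.
Proof.
move=> ST; have TP := pwMN 1; rewrite pw_1 in TP.
by rewrite -[LHS]mul1r -ST -mulrA TP mulr1.
Qed.

Lemma pw_comm S t : S * T = T * S -> S * pw T t = pw T t * S.
Proof. by move=> ST; exact: cfc_lim_comm ST (pwP t). Qed.

Lemma pw_le_arith t x : 0 <= t <= 1 ->
  qf (pw T t) x <= (1 - t) * nr x ^+ 2 + t * qf T x.
Proof.
move=> t01.
have := cfc_lim_le sT _ (pwP t) (@cfc_lim_poly _ _ _ ((1 - t)%:P + t%:P * 'X) T) x.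
rewrite evalpD evalpM evalpX !evalpC -scalerAl mul1r !qfE; apply => r rT.
by rewrite !hornerE powR_le_arith// x0// (sa_within_Sp Tab rT).
Qed.

(** [powR_le_arith] at [r^-1]. It is the source of the lower bound on means. *)
Lemma pwN_le_arith t x : 0 <= t <= 1 ->
  qf (pw T (- t)) x <= (1 - t) * nr x ^+ 2 + t * qf (pw T (- 1)) x.
Proof.
move=> t01; rewrite -(qf_scale t) -qf_1 -(qf_scale (1 - t)) -qf_add.
have tS : cfc_lim (fun x => 1 - t + t * x `^ (-1)) T
   ((1 - t)%:C *: 1 + t%:C *: pw T (- 1)).
  apply: cfc_lim_add.
    by have := @cfc_lim_poly _ _ _ (1 - t)%:P T; rewrite evalpC; apply: eq_cfc_lim => r _; rewrite hornerC.
  have [M _ MP] := itv_bounded (@within_powR R a b (-1) a0).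
  have -> : t%:C *: pw T (- 1) = evalp t%:P T * pw T (- 1).
    by rewrite evalpC -scalerAl mul1r.
  apply: eq_cfc_lim (cfc_lim_mul (F := `|t|) (G := M) _ _ (@cfc_lim_poly _ _ _ t%:P T) (pwP (- 1))).
  - by move=> r _; rewrite hornerC.
  - by move=> r _; rewrite hornerC.
  - by move=> r rT; exact/MP/(sa_within_Sp Tab).
apply: (cfc_lim_le sT _ (pwP (- t)) tS) => r rT.
have r0 : 0 < r by rewrite x0// (sa_within_Sp Tab rT).
have -> : r `^ (- t) = (r `^ (- 1)) `^ t by rewrite -powRrM mulN1r.
by rewrite powR_le_arith// powR_gt0.
Qed.

(** [S] commutes with [T = S * S], hence with its root [W], so [(S - W) * (S + W) = 0]; and [S + W]
    is coercive, hence invertible. *)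
Lemma sqrt_unique S c d : 0 < c -> sa_within c d S -> S * S = T ->
  pw T 2^-1 = S.
Proof.
move=> c0 [sS Sc _] SST; set W := pw T 2^-1.
have SW : S * W = W * S by apply: pw_comm; rewrite -SST mulrA.
have [U [_ SWU]] : inv_op (S + W).
  have [c' [d' [c0' [sW Wc _]]]] := pw_pos 2^-1.
  apply: (coercive_inv c0); first exact: sa_add.
  move=> x; rewrite qfE -[leLHS]addr0 lerD// (le_trans _ (Wc x))//.
  by rewrite mulr_ge0 ?sqr_ge0 ?ltW.
apply/eqP; rewrite eq_sym -subr_eq0; apply/eqP.
by rewrite -[LHS]mulr1 -SWU mulrA mul_diff_sum// SST pw_half subrr mul0r.
Qed.

End PositivePowers.

End Powers.

(** * Geometric mean *)

Section GeometricMean.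
Variables (R : realType) (H : hilbertType R) (H_nt : exists x : H, x != 0).
Local Notation B := (bop H_nt).
Implicit Types (S T U P Q G A D : B) (f g : R -> R) (a b c s t r : R).

Lemma sa_within_weak a b a' b' T : a' <= a -> b <= b' ->
  sa_within a b T -> sa_within a' b' T.
Proof.
move=> aa bb [sT Ta Tb]; split=> // x.
  by rewrite (le_trans _ (Ta x))// ler_wpM2r// sqr_ge0.
by rewrite (le_trans (Tb x))// ler_wpM2r// sqr_ge0.
Qed.

(** Cauchy-Schwarz turns [c |x|^2 <= <S x, x>] into [c |x| <= |S x|], which keeps the lower bound
    positive. *)
Lemma sa_within_conj a b c d S T : 0 < a -> 0 < c -> sa_within c d S ->
  sa_within a b T -> exists a' b', 0 < a' /\ sa_within a' b' (S * T * S).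
Proof.
move=> a0 c0 Scd [sT Ta Tb]; have [sS Sc _] := Scd.
exists (a * c ^+ 2), (`|b| * (`|c| + `|d|) ^+ 2).
split; first by rewrite mulr_gt0// exprn_gt0.
split; first exact: sa_conj.
  move=> x; rewrite qf_conj// (le_trans _ (Ta _))// -mulrA ler_pM2l//.
  rewrite -exprMn ler_pXn2r ?nnegrE ?nr_ge0// ?mulr_ge0 ?nr_ge0 ?(ltW c0)//.
  have [->|x0] := eqVneq x 0; first by rewrite nr0 mulr0 nr_ge0.
  rewrite -nr_gt0 in x0; rewrite -(ler_pM2r x0).
  by rewrite -mulrA -expr2 (le_trans (Sc x))// /qf rin_le.
move=> x; rewrite qf_conj// (le_trans (Tb _))//.
apply: (@le_trans _ _ (`|b| * nr (S x) ^+ 2)).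
  by rewrite ler_wpM2r ?sqr_ge0// ler_norm.
rewrite -mulrA ler_wpM2l// -exprMn ler_pXn2r ?nnegrE ?nr_ge0 ?mulr_ge0 ?nr_ge0 ?addr_ge0//.
exact: (sa_within_nle Scd).
Qed.

Definition relop A D : B := pw A (- 2^-1) * D * pw A (- 2^-1).
Definition gm t A D : B := pw A 2^-1 * pw (relop A D) t * pw A 2^-1.

Section Mean.
Variables (a b c d : R) (A D : B).
Hypotheses (a0 : 0 < a) (Aab : sa_within a b A).
Hypotheses (c0 : 0 < c) (Dcd : sa_within c d D).

Local Notation h := (pw A 2^-1).
Local Notation k := (pw A (- 2^-1)).
Local Notation X := (relop A D).

Let hk : h * k = 1. Proof. exact: pwMN a0 Aab _. Qed.
Let kh : k * h = 1. Proof. exact: pwNM a0 Aab _. Qed.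
Let hh : h * h = A. Proof. exact: pw_half a0 Aab. Qed.
Let sh : sa h. Proof. exact: pw_sa a0 Aab _. Qed.
Let sk : sa k. Proof. exact: pw_sa a0 Aab _. Qed.
Let hXh : h * X * h = D.
Proof. by rewrite /relop !mulrA hk mul1r -mulrA kh mulr1. Qed.

Lemma relop_pos : exists a' b', 0 < a' /\ sa_within a' b' X.
Proof.
have [c' [d' [c0' kcd]]] := pw_pos a0 Aab (- 2^-1).
exact: sa_within_conj c0 c0' kcd Dcd.
Qed.

Lemma gmean_gm t : gmean t A D = gm t A D.
Proof.
have [a' [b' [a0' Xab]]] := relop_pos.
rewrite /gmean !(op_pow_pw a0 Aab).
have -> : k \o D \o k = X by [].
by rewrite (op_pow_pw a0' Xab).
Qed.

Lemma gm_pos t : exists a' b', 0 < a' /\ sa_within a' b' (gm t A D).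
Proof.
have [a' [b' [a0' Xab]]] := relop_pos.
have [c1 [d1 [c1_0 hcd]]] := pw_pos a0 Aab 2^-1.
have [c2 [d2 [c2_0 xcd]]] := pw_pos a0' Xab t.
exact: sa_within_conj c2_0 c1_0 hcd xcd.
Qed.

Let nr_h x : nr (h x) ^+ 2 = qf A x.
Proof. by rewrite -(qf_mulr _ sh) hh. Qed.

Lemma gm_le_arith t x : 0 <= t <= 1 ->
  qf (gm t A D) x <= (1 - t) * qf A x + t * qf D x.
Proof.
move=> t01; have [a' [b' [a0' Xab]]] := relop_pos.
rewrite qf_conj// (le_trans (pw_le_arith a0' Xab _ t01))// nr_h lerD2l.
by rewrite -[in leRHS]hXh qf_conj.
Qed.

(** In other words, the inverse of the mean is the congruence by [A^(-1/2)] of [X^(-t)], with [X]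
    the relative operator. *)
Lemma gm_inv t : pw (gm t A D) (- 1) = k * pw X (- t) * k.
Proof.
have [a' [b' [a0' Xab]]] := relop_pos.
have [c' [d' [c0' Gcd]]] := gm_pos t.
apply: (pw_inv c0' Gcd); rewrite /gm !mulrA -(mulrA _ k h) kh mulr1.
by rewrite -(mulrA k) (pwNM a0' Xab) mulr1 kh.
Qed.

Lemma pwN1_relop : pw D (- 1) = k * pw X (- 1) * k.
Proof.
have [a' [b' [a0' Xab]]] := relop_pos.
have XX := pwNM a0' Xab 1; rewrite (pw_1 a0' Xab) in XX.
apply: (pw_inv c0 Dcd); rewrite -{2}hXh; move: (relop A D) XX => Y XX.
rewrite !mulrA -(mulrA _ k h) kh mulr1.
by rewrite -(mulrA k) XX mulr1 kh.
Qed.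

Lemma gm_inv_le_arith t x : 0 <= t <= 1 ->
  qf (pw (gm t A D) (- 1)) x <=
  (1 - t) * qf (pw A (- 1)) x + t * qf (pw D (- 1)) x.
Proof.
move=> t01; have [a' [b' [a0' Xab]]] := relop_pos.
rewrite gm_inv qf_conj// (le_trans (pwN_le_arith a0' Xab _ t01))//.
rewrite -(qf_mulr _ sk) (pwM a0 Aab) pwN1_relop qf_conj//.
by rewrite (_ : - 2^-1 + - 2^-1 = -1) ?lexx//; field.
Qed.

Lemma gm_lip : exists2 K, 0 <= K & forall s t, 0 <= s <= 1 -> 0 <= t <= 1 ->
  nle (gm s A D - gm t A D) (K * `|s - t|).
Proof.
have [a' [b' [a0' Xab]]] := relop_pos.
have [K K0 XK] := powR_lip b' a0'; have [M M0 hM] := bop_bound h.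
exists (M * K * M); first by rewrite !mulr_ge0// ltW.
move=> s t s01 t01; rewrite /gm -mulrBl -mulrBr.
have -> : M * K * M * `|s - t| = M * (K * `|s - t|) * M by ring.
have Kst : 0 <= K * `|s - t| by rewrite mulr_ge0.
apply: nle_mul; [by rewrite mulr_ge0// ltW| |exact: hM].
apply: nle_mul; [exact: ltW|exact: hM|].
apply: (fc_norm Xab) => //; [exact: within_powR|exact: within_powR|].
by move=> x xab; exact: XK.
Qed.

(** [A <= D] means [1 <= X] after congruence by [A^(-1/2)]; then [1 <= X^(1/2)], and congruence by
    [A^(1/2)] returns to [A]. *)
Lemma gm_half_ge : ple A D -> ple A (gm 2^-1 A D).
Proof.
move=> AD x; have [a' [b' [a0' Xab]]] := relop_pos.
have X1 : sa_within 1 b' X.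
  have [sX _ Xb] := Xab; split=> // y.
  rewrite mul1r qf_conj// (le_trans _ (AD _))//.
  by rewrite -nr_h -bop_mulE hk.
rewrite [leRHS]qf_conj// -nr_h.
rewrite -[leLHS]mul1r.
apply: (fc_ge X1); first exact: within_powR.
move=> y /andP[y1 _]; rewrite -[leLHS](powRr0 y).
by apply: ler_powR => //; lra.
Qed.

End Mean.

Lemma pw_inv_within a b T : 0 < a -> sa_within a b T ->
  sa_within b^-1 a^-1 (pw T (- 1)).
Proof.
move=> a0 Tab; apply: (fc_within Tab); first exact: within_powR.
move=> x /andP[ax xb]; have x0 := lt_le_trans a0 ax.
rewrite powR_inv1 ?(ltW x0)// !lef_pV2 ?posrE ?ax ?xb//.
exact: lt_le_trans xb.
Qed.

Lemma ge_of_inv_le a S T : 0 < a -> sa S -> S * T = 1 ->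
  (forall x, 0 <= qf S x <= a^-1 * nr x ^+ 2) ->
  forall x, a * nr x ^+ 2 <= qf T x.
Proof.
move=> a0 sS ST Sa x.
have STx : S (T x) = x by rewrite -bop_mulE ST.
(* Expanding the form of [S] at this vector gives [2 a |x|^2 <= <T x, x> + a^2 <S x, x>], whose last
   term is at most [a |x|^2]. *)
have /andP[+ _] := Sa (T x - a%:C *: x).
rewrite /qf bopB bopZ STx !(rinDl, rinDr, rinNl, rinNr, rinZl, rinZr) (sS x) STx.
rewrite -nr_sqr (rinC x).
have : a * qf S x <= nr x ^+ 2.
  by have /andP[_] := Sa x; rewrite ler_pdivlMl.
rewrite -/(qf S x).
move: (qf S x) (rin (T x) x) (nr x ^+ 2) => u v w uw.
have : a * (a * u) <= a * w by rewrite ler_pM2l.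
lra.
Qed.

(* The lower bound comes from
[(A #_t D)^-1 <= (1 - t) A^-1 + t D^-1 <= a^-1]. *)
Lemma gm_within a b A D t : 0 < a -> sa_within a b A -> sa_within a b D ->
  0 <= t <= 1 -> sa_within a b (gm t A D).
Proof.
move=> a0 Aab Dab /[dup] t01 /andP[t0 t1].
have [c [d [c0 Gcd]]] := gm_pos a0 Aab a0 Dab t.
have [sG Gc _] := Gcd; split => //.
  have [sGi _ _] := pw_inv_within c0 Gcd.
  have [_ _ Ai] := pw_inv_within a0 Aab; have [_ _ Di] := pw_inv_within a0 Dab.
  have [c' [d' [c0' [_ Gic _]]]] := pw_pos c0 Gcd (- 1).
  apply: (ge_of_inv_le (S := pw (gm t A D) (- 1)) a0 sGi).
    by rewrite -{2}(pw_1 c0 Gcd) (pwNM c0 Gcd).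
  move=> x; apply/andP; split.
    by rewrite (le_trans _ (Gic x))// mulr_ge0 ?sqr_ge0 ?ltW.
  rewrite (le_trans (gm_inv_le_arith a0 Aab a0 Dab _ t01))//.
  have -> : a^-1 * nr x ^+ 2 = (1 - t) * (a^-1 * nr x ^+ 2) + t * (a^-1 * nr x ^+ 2) by ring.
  by rewrite lerD// ler_wpM2l// subr_ge0.
move=> x; rewrite (le_trans (gm_le_arith a0 Aab a0 Dab _ t01))//.
have [_ _ Ab] := Aab; have [_ _ Db] := Dab.
have -> : b * nr x ^+ 2 = (1 - t) * (b * nr x ^+ 2) + t * (b * nr x ^+ 2) by ring.
by rewrite lerD// ler_wpM2l// subr_ge0.
Qed.

(* The geometric mean of [P] and [Q] is the unique positive solution of the
Riccati equation [G P^-1 G = Q]. *)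
Lemma gm_riccati a b c d e e' P Q G : 0 < a -> sa_within a b P ->
  0 < c -> sa_within c d Q -> 0 < e -> sa_within e e' G ->
  G * pw P (- 1) * G = Q -> gm 2^-1 P Q = G.
Proof.
move=> a0 Pab c0 Qcd e0 Gee GPG.
have [a' [b' [a0' Xab]]] := relop_pos a0 Pab c0 Qcd.
have hk := pwMN a0 Pab 2^-1; have kh := pwNM a0 Pab 2^-1.
have [c1 [d1 [c1_0 kcd]]] := pw_pos a0 Pab (- 2^-1).
have [c2 [d2 [c2_0 Ycd]]] := sa_within_conj e0 c1_0 kcd Gee.
(* With [k = P^(-1/2)], the square of [k G k] is [k G P^-1 G k = k Q k], the relative operator; so
   [k G k] is its positive root. *)
rewrite /gm (sqrt_unique a0' Xab c2_0 Ycd).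
  by rewrite !mulrA hk mul1r -mulrA kh mulr1.
have kk : pw P (- 2^-1) * pw P (- 2^-1) = pw P (- 1).
  by rewrite (pwM a0 Pab); congr (pw P _); field.
by rewrite /relop -GPG -kk; move: (pw P _) => k; rewrite !mulrA.
Qed.

Lemma gm_gm a b c d A D t : 0 < a -> sa_within a b A -> 0 < c ->
  sa_within c d D ->
  gm 2^-1 (gm t A D) (gm (1 - t) A D) = gm 2^-1 A D.
Proof.
move=> a0 Aab c0 Dcd.
have [a1 [b1 [a1_0 P1]]] := gm_pos a0 Aab c0 Dcd t.
have [a2 [b2 [a2_0 P2]]] := gm_pos a0 Aab c0 Dcd (1 - t).
have [a3 [b3 [a3_0 P3]]] := gm_pos a0 Aab c0 Dcd 2^-1.
have [a' [b' [a0' Xab]]] := relop_pos a0 Aab c0 Dcd.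
apply: (gm_riccati a1_0 P1 a2_0 P2 a3_0 P3).
have hk := pwMN a0 Aab 2^-1; have kh := pwNM a0 Aab 2^-1.
(* The exponents in [G P^-1 G] add up to [1/2 - t + 1/2]. *)
have XXX : pw (relop A D) 2^-1 * pw (relop A D) (- t) * pw (relop A D) 2^-1 =
    pw (relop A D) (1 - t).
  by rewrite !(pwM a0' Xab); congr (pw _ _); field.
rewrite (gm_inv a0 Aab c0 Dcd) /gm -XXX.
move: (pw (relop A D) _) (pw (relop A D) _) => u v.
move: (pw A 2^-1) (pw A (- 2^-1)) hk kh => h k hk kh.
by rewrite !mulrA -(mulrA _ h k) hk mulr1 -(mulrA _ k h) kh mulr1.
Qed.

(** The bound [K] on [p(T)] is carried along because the induction step, a product rule for
    [p * 'X], needs it. No commutation of [S] and [T] is involved. *)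
Lemma evalp_lip (M : R) (p : {poly R}) : 0 <= M ->
  exists K L, [/\ 0 <= K, 0 <= L, forall T, nle T M -> nle (evalp p T) K &
    forall S T e, 0 <= e -> nle S M -> nle T M -> nle (S - T) e ->
      nle (evalp p S - evalp p T) (L * e)].
Proof.
move=> M0; elim/poly_ind: p => [|p r [K [L [K0 L0 pK pL]]]].
  have z0 T : evalp 0 T = 0 by rewrite /evalp !rmorph0.
  by exists 0, 0; split=> // [T _|S T e _ _ _ _] x;
    rewrite !z0 ?subrr bop_0E nr0 !mul0r.
exists (K * M + `|r|), (L * M + K); split; rewrite ?addr_ge0 ?mulr_ge0//.
  move=> T TM; rewrite evalpD evalpM evalpX evalpC -[`|r|]mulr1.
  by apply: nle_add; [apply: nle_mul => //; exact: pK|apply: nle_scale; exact: nle_1].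
move=> S T e e0 SM TM ST.
rewrite !evalpD !evalpM !evalpX !evalpC opprD addrACA subrr addr0.
have -> : evalp p S * S - evalp p T * T =
    (evalp p S - evalp p T) * S + evalp p T * (S - T).
  by rewrite mulrBl mulrBr subrKA.
rewrite [(_ + K) * e]mulrDl [L * M * e]mulrAC; apply: nle_add; apply: nle_mul => //.
- by rewrite mulr_ge0.
- exact: pL.
- exact: pK.
Qed.

(** Uniform over all operators with bounds [a] and [b]: one polynomial approximates [f] on [[a, b]],
    and it is Lipschitz on the corresponding norm ball. *)
Lemma fc_unif f a b e : {within `[a, b], continuous f} -> 0 < e ->
  exists2 d, 0 < d & forall S T, sa_within a b S -> sa_within a b T ->
    nle (S - T) d -> nle (fc f S - fc f T) e.
Proof.
move=> cf e0; have e4 : 0 < e / 4 by rewrite divr_gt0.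
have [p pf] := weierstrass cf e4.
have M0 : 0 <= `|a| + `|b| by rewrite addr_ge0.
have [K [L [K0 L0 _ pL]]] := evalp_lip p M0.
have L1 : 0 < L + 1 by lra.
exists (e / 4 / (L + 1)); first by rewrite divr_gt0.
move=> S T Sab Tab ST.
have near U : sa_within a b U -> nle (fc f U - evalp p U) (e / 4).
  move=> Uab; have [sU _ _] := Uab.
  apply: (cfc_lim_norm (ltW e4) sU _ (fcP Uab cf) (@cfc_lim_poly _ _ _ p U)).
  by move=> r rU; rewrite distrC pf// (sa_within_Sp Uab rU).
have h : nle (evalp p S - evalp p T) (L * (e / 4 / (L + 1))).
  apply: pL => //; [by rewrite divr_ge0 ?ltW|exact: sa_within_nle Sab|exact: sa_within_nle Tab].
have := nle_trans (nle_trans (near S Sab) h) (nle_sym (near T Tab)).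
apply: nle_weak.
have -> : L * (e / 4 / (L + 1)) = e / 4 * (L / (L + 1)) by field; rewrite gt_eqF.
have : L / (L + 1) <= 1 by rewrite ler_pdivrMr//; lra.
nra.
Qed.

End GeometricMean.

(** * Riemann integral *)

Section Overlap.
Variable R : realType.
Implicit Types (a b c d x y z : R).

(* [clamp a b d - clamp a b c] is the length of [[a, b]] intersected with
[[c, d]]. *)
Definition clamp a b z : R := Num.min b (Num.max a z).

Lemma clamp_low a b z : a <= b -> z <= a -> clamp a b z = a.
Proof. by move=> ab za; rewrite /clamp (max_idPl _)// (min_idPr _). Qed.

Lemma clamp_high a b z : a <= b -> b <= z -> clamp a b z = b.
Proof. by move=> ab bz; rewrite /clamp (min_idPl _)// le_max bz orbT. Qed.

Lemma clampE a b z : a <= b ->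
  clamp a b z = if z <= a then a else if b <= z then b else z.
Proof.
move=> ab; case: (leP z a) => [za|az]; first exact: clamp_low.
case: (leP b z) => [bz|zb]; first exact: clamp_high.
by rewrite /clamp (max_idPr (ltW az)) (min_idPr (ltW zb)).
Qed.

Lemma clamp_sym a b c d : a <= b -> c <= d ->
  clamp a b d - clamp a b c = clamp c d b - clamp c d a.
Proof.
move=> ab cd; rewrite !clampE//.
case: (leP d a) => h1; case: (leP b d) => h2; case: (leP c a) => h3;
  case: (leP b c) => h4; case: (leP d b) => h5; case: (leP a c) => h6; lra.
Qed.

Lemma clamp_mono a b c d : c <= d -> clamp a b c <= clamp a b d.
Proof.
by move=> cd; rewrite /clamp le_min2// le_max2.
Qed.

Lemma clamp_neq a b c d : a <= b -> c <= d ->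
  clamp a b d - clamp a b c != 0 -> a < d /\ c < b.
Proof.
move=> ab cd h; split; rewrite ltNge; apply/negP => le; move/eqP: h; apply.
  by rewrite /clamp !(max_idPl _)// ?subrr// (le_trans cd).
by rewrite /clamp !(min_idPl _) ?subrr// le_max ?le ?orbT// (le_trans le cd) orbT.
Qed.

(** Reversing the index, [i |-> n - i], sends each midpoint [s] to [1 - s], so twice the sum is a
    mean of [phi s + phi (1 - s)]. *)
Lemma sum_midpoints (phi : R -> R) n c :
  (forall t, 0 <= t <= 1 -> 2 * c <= phi t + phi (1 - t)) ->
  c <= \sum_(i < n.+1) n.+1%:R^-1 * phi (i.*2.+1%:R / n.+1.*2%:R).
Proof.
move=> hphi; set S := \sum_(i < _) _.
have n0 : 0 < n.+1%:R :> R by rewrite ltr0n.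
have mE (m : nat) : m.*2%:R = 2 * m%:R :> R by rewrite -mul2n natrM.
have -> : c = 2^-1 * (2 * c) by field.
have -> : S = 2^-1 * (S + S) by field.
rewrite ler_pM2l// {2}/S (reindex_inj rev_ord_inj) -big_split /=.
have -> : 2 * c = \sum_(i < n.+1) n.+1%:R^-1 * (2 * c).
  by rewrite sumr_const card_ord -[RHS]mulr_natl mulVKf// gt_eqF.
apply: ler_sum => i _; rewrite -mulrDr ler_pM2l ?invr_gt0//.
have -> : (n - i).*2.+1%:R / n.+1.*2%:R = 1 - i.*2.+1%:R / n.+1.*2%:R :> R.
  have il : (i <= n)%N by rewrite -ltnS.
  rewrite -[(n - i).*2.+1]addn1 -[i.*2.+1]addn1 !natrD !mE natrB//.
  move: (i : nat) => j; have nS : n.+1%:R = n%:R + 1 :> R by rewrite natr1.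
  rewrite nS in n0 *.
  by field; rewrite gt_eqF.
apply: hphi; rewrite divr_ge0//= ler_pdivrMr ?ltr0n ?double_gt0// mul1r ler_nat.
by rewrite ltn_double.
Qed.

End Overlap.

Section Integral.
Variables (R : realType) (H : hilbertType R) (H_nt : exists x : H, x != 0).
Local Notation B := (bop H_nt).
Implicit Types (S T U : B) (F G : R -> B) (s t d e : R) (u v xi eta : nat -> R).

Definition unif_cont01 F := forall e, 0 < e -> exists2 d, 0 < d &
  forall s t, 0 <= s <= 1 -> 0 <= t <= 1 -> `|s - t| < d -> nle (F s - F t) e.

Definition tagged n u xi d := [/\ u 0%N = 0, u n = 1 &
  forall i, (i < n)%N -> u i <= xi i <= u i.+1 /\ u i.+1 - u i < d].

Definition riemann_sum F n u xi : B :=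
  \sum_(i < n) (u i.+1 - u i)%:C *: F (xi i).

Lemma tagged_le n u xi d i j : tagged n u xi d -> (i <= j <= n)%N -> u i <= u j.
Proof.
move=> [_ _ up]; elim: j => [|j IH] /andP[ij jn].
  by move: ij; rewrite leqn0 => /eqP ->.
move: ij; rewrite leq_eqVlt => /orP[/eqP -> //|ij].
have [/andP[h1 h2] _] := up j jn.
by apply: le_trans (IH _) (le_trans h1 h2); rewrite -ltnS ij ltnW.
Qed.

Lemma tagged01 n u xi d i : tagged n u xi d -> (i < n)%N ->
  [/\ 0 <= u i, u i <= u i.+1, u i.+1 <= 1 & 0 <= xi i <= 1].
Proof.
move=> tu i_n; have [u0 un up] := tu; have [/andP[h1 h2] _] := up i i_n.
have ui0 : 0 <= u i by rewrite -u0; apply: (tagged_le tu); rewrite leq0n ltnW.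
have ui1 : u i.+1 <= 1 by rewrite -un; apply: (tagged_le tu); rewrite i_n leqnn.
split=> //; first exact: le_trans h2.
by rewrite (le_trans ui0)// (le_trans h2).
Qed.

Lemma nle_sum (I : finType) (F : I -> B) (e : I -> R) :
  (forall i, nle (F i) (e i)) -> nle (\sum_i F i) (\sum_i e i).
Proof.
move=> Fe; elim/big_ind2: _ => //; last by move=> S a T b; exact: nle_add.
by move=> x; rewrite bop_0E nr0 mul0r.
Qed.

Lemma sum_overlap n u xi d a b : tagged n u xi d -> 0 <= a -> a <= b -> b <= 1 ->
  \sum_(j < n) (clamp a b (u j.+1) - clamp a b (u j)) = b - a.
Proof.
move=> [u0 un _] a0 ab b1.
rewrite -(big_mkord xpredT (fun j => clamp a b (u j.+1) - clamp a b (u j))).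
by rewrite telescope_sumr// un u0 clamp_high// clamp_low.
Qed.

(** Both sums are rewritten over pairs of intervals, weighted by overlap, in place of a common
    refinement. Intervals that overlap and are shorter than [d / 2] have tags less than [d]
    apart. *)
Lemma riemann_sum_close F n m u v xi eta d e :
  (forall s t, 0 <= s <= 1 -> 0 <= t <= 1 -> `|s - t| < d -> nle (F s - F t) e) ->
  tagged n u xi (d / 2) -> tagged m v eta (d / 2) ->
  nle (riemann_sum F n u xi - riemann_sum F m v eta) e.
Proof.
move=> Fd tu tv.
(* [l i j] is the length of the overlap of the two intervals. *)
pose l (i j : nat) : R := clamp (u i) (u i.+1) (v j.+1) - clamp (u i) (u i.+1) (v j).
have lu (i : 'I_n) : \sum_(j < m) l i j = u i.+1 - u i.
  by have [? ? ? _] := tagged01 tu (ltn_ord i); exact: sum_overlap tv _ _ _.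
have lv (j : 'I_m) : \sum_(i < n) l i j = v j.+1 - v j.
  have [v0 vj v1 _] := tagged01 tv (ltn_ord j).
  rewrite -(sum_overlap tu v0 vj v1); apply: eq_bigr => i _.
  by have [_ ui _ _] := tagged01 tu (ltn_ord i); exact: clamp_sym.
have -> : riemann_sum F n u xi - riemann_sum F m v eta =
    \sum_(i < n) \sum_(j < m) (l i j)%:C *: (F (xi i) - F (eta j)).
  have -> : riemann_sum F n u xi = \sum_(i < n) \sum_(j < m) (l i j)%:C *: F (xi i).
    by apply: eq_bigr => i _; rewrite -lu rmorph_sum scaler_suml.
  have -> : riemann_sum F m v eta = \sum_(i < n) \sum_(j < m) (l i j)%:C *: F (eta j).
    rewrite exchange_big; apply: eq_bigr => j _.
    by rewrite -lv rmorph_sum scaler_suml.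
  rewrite -sumrB; apply: eq_bigr => i _; rewrite -sumrB; apply: eq_bigr => j _.
  by rewrite scalerBr.
have -> : e = \sum_(i < n) \sum_(j < m) l i j * e.
  under eq_bigr do rewrite -mulr_suml lu.
  rewrite -mulr_suml -(big_mkord xpredT (fun i => u i.+1 - u i)) telescope_sumr//.
  by have [-> -> _] := tu; rewrite subr0 mul1r.
apply: nle_sum => i; apply: nle_sum => j.
have [_ _ /(_ i (ltn_ord i))[/andP[ux xu] ud]] := tu.
have [_ _ /(_ j (ltn_ord j))[/andP[vx xv] vd]] := tv.
have [_ ui _ xi01] := tagged01 tu (ltn_ord i).
have [_ vj _ eta01] := tagged01 tv (ltn_ord j).
have [->|lij] := eqVneq (l i j) 0.
  by rewrite scale0r mul0r => x; rewrite bop_0E nr0 mul0r.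
have [uv vu] := clamp_neq ui vj lij.
have lij0 : 0 <= l i j by rewrite subr_ge0 clamp_mono.
rewrite -[X in X * e](ger0_norm lij0); apply: nle_scale.
by apply: Fd => //; rewrite ltr_norml; lra.
Qed.

Definition midpoint_sum F n : B :=
  \sum_(i < n.+1) (n.+1%:R^-1)%:C *: F (i.*2.+1%:R / n.+1.*2%:R).

Lemma midpoint_tagged n d : n.+1%:R^-1 < d ->
  tagged n.+1 (fun i => i%:R / n.+1%:R) (fun i => i.*2.+1%:R / n.+1.*2%:R) d.
Proof.
have n0 : 0 < n.+1%:R :> R by rewrite ltr0n.
move=> nd; split; [by rewrite mul0r|by rewrite mulfV// gt_eqF|].
move=> i _; split; last by rewrite -mulrBl -[i.+1]addn1 natrD addrAC subrr add0r mul1r.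
have -> : i.*2.+1%:R / n.+1.*2%:R = (i%:R + 2^-1) / n.+1%:R :> R.
  rewrite -[i.*2.+1]addn1 -!mul2n natrD !natrM.
  by field; rewrite gt_eqF.
rewrite !ler_pM2r ?invr_gt0// -[i.+1]addn1 natrD; apply/andP; split; lra.
Qed.

Lemma midpoint_sumE F n : midpoint_sum F n =
  riemann_sum F n.+1 (fun i => i%:R / n.+1%:R) (fun i => i.*2.+1%:R / n.+1.*2%:R).
Proof.
apply: eq_bigr => i _; congr (_%:C *: _).
by rewrite -mulrBl -[i.+1]addn1 natrD addrAC subrr add0r mul1r.
Qed.

(** The midpoint sums are Cauchy and define [S]; any fine tagged sum is close to them. Agreement of
    [F] with [Fb] on [[0, 1]] suffices, as all tags lie there. *)
Lemma opintP (F : R -> H -> H) (Fb : R -> B) : unif_cont01 Fb ->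
  (forall t, 0 <= t <= 1 -> F t = Fb t) ->
  exists2 S : B, opint F 0 1 = S &
    forall e, 0 < e -> exists N, forall n, (N <= n)%N -> nle (S - midpoint_sum Fb n) e.
Proof.
move=> uF FE.
have cauchy e : 0 < e -> exists N, forall m n, (N <= m)%N -> (N <= n)%N ->
    nle (midpoint_sum Fb m - midpoint_sum Fb n) e.
  move=> e0; have [d d0 dF] := uF e e0.
  (* [d / 4] because [invS_small] gives a weak inequality and the mesh must be strictly below
     [d / 2]. *)
  have [N Nd] := invS_small (divr_gt0 d0 (ltr0Sn _ 3) : 0 < d / 4).
  exists N => m n Nm Nn; rewrite !midpoint_sumE.
  by apply: (riemann_sum_close dF); apply: midpoint_tagged;
    apply: (@le_lt_trans _ _ (d / 4)); rewrite ?Nd//; lra.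
have [S SF] := bop_complete cauchy.
exists S => //; apply: xget_unique.
  move=> e e0; have e2 : 0 < e / 2 by rewrite divr_gt0.
  have [d d0 dF] := uF _ e2; exists (d / 2); first by rewrite divr_gt0.
  move=> n u xi u0 un up; have tu : tagged n u xi (d / 2) by split.
  have -> : \sum_(i < n) (u i.+1 - u i)%:C *: F (xi i) = riemann_sum Fb n u xi.
    rewrite bfun_sum; apply: eq_bigr => i _.
    by have [_ _ _ xi01] := tagged01 tu (ltn_ord i); rewrite FE.
  have [N NS] := SF _ e2.
  have [N' Nd] := invS_small (divr_gt0 d0 (ltr0Sn _ 3) : 0 < d / 4).
  apply/opnorm_leE; rewrite [e]splitr.
  apply: (@nle_trans _ _ _ S (midpoint_sum Fb (maxn N N'))).
    exact/NS/leq_maxl.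
  rewrite midpoint_sumE; apply: (riemann_sum_close dF) => //.
  apply: midpoint_tagged; apply: (@le_lt_trans _ _ (d / 4)); last lra.
  exact/Nd/leq_maxr.
(* Uniqueness: a candidate [S'] is compared with [S] through one fine midpoint sum. *)
move=> S' FS'; apply: nle_small => e e0.
have e2 : 0 < e / 2 by rewrite divr_gt0.
have [d d0 dF] := FS' _ e2; have [N NS] := SF _ e2.
have [N' Nd] := invS_small (divr_gt0 d0 (ltr0Sn _ 1) : 0 < d / 2).
pose n := maxn N N'.
have tm : tagged n.+1 (fun i => i%:R / n.+1%:R) (fun i => i.*2.+1%:R / n.+1.*2%:R) d.
  apply: midpoint_tagged; apply: (@le_lt_trans _ _ (d / 2)); last lra.
  exact/Nd/leq_maxr.
have [u0 un up] := tm.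
have := dF _ _ _ u0 un up; move/opnorm_leE.
have -> : \sum_(i < n.+1) (i.+1%:R / n.+1%:R - i%:R / n.+1%:R)%:C *:
    F (i.*2.+1%:R / n.+1.*2%:R) = midpoint_sum Fb n.
  rewrite midpoint_sumE bfun_sum; apply: eq_bigr => i _.
  by have [_ _ _ xi01] := tagged01 tm (ltn_ord i); rewrite FE.
move=> h1 x; have := h1 x; have := NS n (leq_maxl _ _) x.
have -> : (S' - bfun S) x = (S' - bfun (midpoint_sum Fb n)) x - (S - midpoint_sum Fb n) x.
  by rewrite bop_subE opprB; exact: (esym (subrKA _ _ _)).
move=> h2 h3; rewrite (le_trans (nrB _ _))// [e]splitr mulrDl lerD//.
Qed.

Lemma midpoint_sum_sa F n : (forall t, 0 <= t <= 1 -> sa (F t)) ->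
  sa (midpoint_sum F n).
Proof.
move=> sF; have tm := @midpoint_tagged n 2 _.
(* The mesh bound 2 in [tm] exceeds every [n.+1%:R^-1]; the partition serves only to place the tags
   in [[0, 1]]. *)
rewrite /midpoint_sum; apply: (big_ind (fun S : B => sa S)).
- exact: sa_0.
- exact: sa_add.
move=> i _; apply/sa_scale/sF.
have n1 : n.+1%:R^-1 < 2 :> R.
  by rewrite (@le_lt_trans _ _ 1)// ?ltr1n// invf_le1 ?ltr0n// ler1n.
by have [_ _ _ ] := tagged01 (tm n1) (ltn_ord i).
Qed.

Lemma qf_midpoint_sum F n x : qf (midpoint_sum F n) x =
  \sum_(i < n.+1) n.+1%:R^-1 * qf (F (i.*2.+1%:R / n.+1.*2%:R)) x.
Proof.
rewrite /midpoint_sum; elim/big_rec2: _ => [|i y S _ <-]; first by rewrite qf_0.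
by rewrite qf_add qf_scale.
Qed.

Section Limit.
Variables (F : R -> B) (S : B).
Hypothesis FS : forall e, 0 < e ->
  exists N, forall n, (N <= n)%N -> nle (S - midpoint_sum F n) e.

Lemma integral_sa : (forall t, 0 <= t <= 1 -> sa (F t)) -> sa S.
Proof.
move=> sF; apply: sa_lim => e /FS[N NS].
by exists (midpoint_sum F N); [exact: midpoint_sum_sa|exact: NS].
Qed.

(** The hypothesis pairs [t] with [1 - t] because the bound by [f(A # B)] is available only in that
    form. *)
Lemma integral_ge c x :
  (forall t, 0 <= t <= 1 -> 2 * c <= qf (F t) x + qf (F (1 - t)) x) ->
  c <= qf S x.
Proof.
move=> cF; apply: qf_lim_ge => e /FS[N NS].
exists (midpoint_sum F N); last exact: NS.
by rewrite qf_midpoint_sum; exact: sum_midpoints (fun t => qf (F t) x) N c cF.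
Qed.

End Limit.

Lemma midpoint_sumN F n : midpoint_sum (fun t => - F t) n = - midpoint_sum F n.
Proof. by rewrite /midpoint_sum -sumrN; apply: eq_bigr => i _; rewrite scalerN. Qed.

Lemma midpoint_sumB F G n :
  midpoint_sum (fun t => F t - G t) n = midpoint_sum F n - midpoint_sum G n.
Proof. by rewrite /midpoint_sum -sumrB; apply: eq_bigr => i _; rewrite scalerBr. Qed.

Lemma integral_le F S c x :
  (forall e, 0 < e -> exists N, forall n, (N <= n)%N ->
    nle (S - midpoint_sum F n) e) ->
  (forall t, 0 <= t <= 1 -> qf (F t) x + qf (F (1 - t)) x <= 2 * c) ->
  qf S x <= c.
Proof.
move=> FS Fc; rewrite -lerN2 -qf_opp.
apply: (@integral_ge (fun t => - F t) (- S)).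
  move=> e /FS[N NS]; exists N => n /NS.
  by rewrite midpoint_sumN -opprD; exact: nle_opp.
by move=> t t01; have := Fc t t01; rewrite !qfE; lra.
Qed.

Lemma integral_mono F G S T :
  (forall e, 0 < e -> exists N, forall n, (N <= n)%N ->
    nle (S - midpoint_sum F n) e) ->
  (forall e, 0 < e -> exists N, forall n, (N <= n)%N ->
    nle (T - midpoint_sum G n) e) ->
  (forall t, 0 <= t <= 1 -> ple (F t) (G t)) -> ple S T.
Proof.
move=> FS GT FG x; rewrite -subr_ge0 -qf_sub.
apply: (@integral_ge (fun t => G t - F t)).
  move=> e e0; have e2 : 0 < e / 2 by rewrite divr_gt0.
  have [N NS] := FS _ e2; have [N' NT] := GT _ e2.
  exists (maxn N N') => n; rewrite geq_max => /andP[/NS h1 /NT h2].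
  rewrite midpoint_sumB opprD addrACA -opprD [e]splitr.
  exact: nle_sub.
(* Here [c = 0]: the pointwise inequalities at [t] and [1 - t] are added. *)
move=> t /[dup] t01 /andP[t0 t1]; rewrite !qfE mulr0.
have := FG t t01 x; have := FG (1 - t) _ x; rewrite subr_ge0 gerBl t0 t1.
by move=> /(_ isT); lra.
Qed.

End Integral.

(** * Hermite-Hadamard inequalities *)

Section OperatorOrder.
Variables (R : realType) (H : hilbertType R) (H_nt : exists x : H, x != 0).
Local Notation B := (bop H_nt).
Implicit Types (S T A D : B) (f : R -> R) (a b c t r : R) (I : interval R).

Lemma rin_ir (x y : H) : rin x ('i *: y) = complex.Im (inner x y).
Proof.
rewrite /rin linearZr_LR /=; by case: (inner x y) => u v /=; ring.
Qed.

Lemma rin_il (x y : H) : rin ('i *: x) y = - complex.Im (inner x y).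
Proof. by rewrite /rin linearZl_LR mulrC ReiNIm. Qed.

Lemma rin_ii (x y : H) : rin ('i *: x) ('i *: y) = rin x y.
Proof.
by rewrite rin_il -rin_ir scalerA -expr2 sqr_i scaleN1r rinNr opprK.
Qed.

Lemma Im_innerC (x y : H) : complex.Im (inner y x) = - complex.Im (inner x y).
Proof. by rewrite -rin_il rinC rin_ir. Qed.

Lemma inner_sa T x : sa T -> inner (T x) x = (qf T x)%:C.
Proof.
move=> sT.
have : rin (T x) ('i *: x) = rin x (T ('i *: x)) by rewrite sT.
rewrite bopZ !rin_ir (Im_innerC (T x) x) /qf /rin.
by case: (inner (T x) x) => u v /= h; congr (_ +i* _); lra.
Qed.

Lemma op_leP S T : sa S -> sa T -> op_le S T <-> ple S T.
Proof.
move=> sS sT; have E x : inner ((bfun T - bfun S) x) x = (qf T x - qf S x)%:C.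
  by rewrite -qf_sub -inner_sa//; exact: sa_sub.
by split=> ST x; have := ST x; rewrite E ler0c subr_ge0.
Qed.

(** The form is real at [x + 'i *: y], and its imaginary part there is the defect of symmetry of [T]
    at [x] and [y]. *)
Lemma pos_sa T : (forall x, 0 <= inner (T x) x) -> sa T.
Proof.
move=> T0 x y; rewrite [RHS]rinC.
have T_im z : complex.Im (inner (T z) z) = 0 by rewrite ger0_Im.
have := T_im (x + 'i *: y).
rewrite -rin_ir bopD bopZ scalerDr scalerA -expr2 sqr_i scaleN1r.
by rewrite !(rinDl, rinDr, rinNr) rin_ir T_im rin_ii rin_il T_im; lra.
Qed.

Lemma strictly_positive_sa T : strictly_positive T -> sa T.
Proof.
move=> [_ T0]; apply: pos_sa => x; have [->|x0] := eqVneq x 0.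
  by rewrite linear0r.
by rewrite ltW// T0.
Qed.

Lemma within_strictly_positive a b T : 0 < a -> sa_within a b T ->
  strictly_positive T.
Proof.
move=> a0 [sT Ta _]; split; first exact: bopP.
move=> x x0; rewrite inner_sa// ltcR (lt_le_trans _ (Ta x))//.
by rewrite mulr_gt0// exprn_gt0// nr_gt0.
Qed.

Lemma within_Sp_sub a b T I : (forall x, a <= x <= b -> x \in I) ->
  sa_within a b T -> Sp_sub T I.
Proof.
move=> abI Tab z zT; have [sT _ _] := Tab; have zE := Sp_real sT zT.
exists (complex.Re z); last by rewrite -zE.
by apply: abI; rewrite (sa_within_Sp Tab)// -zE.
Qed.

(** The extreme values of the form belong to the spectrum, hence to [I]; so even an open or
    unbounded [I] contains a compact interval that bounds [T]. *)
Lemma Sp_sub_within T I : sa T -> Sp_sub T I ->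
  exists a b, [/\ a \in I, b \in I & sa_within a b T].
Proof.
move=> sT TI; have [m [M [mT MT TmM]]] := within_spectrum sT.
exists m, M; split => //.
  by have [x xI /complexI <-] := TI _ mT.
by have [x xI /complexI <-] := TI _ MT.
Qed.

End OperatorOrder.

Lemma lipschitz_modulus (R : realType) (K z e : R) : 0 <= K -> 0 <= z ->
  z < e / (K + 1) -> K * z <= e.
Proof.
move=> K0 z0; rewrite ltr_pdivlMr; last by lra.
nra.
Qed.

Lemma midpoint_le (R : realFieldType) (u v p q : R) :
  u <= v -> v <= (1 - 2^-1) * p + 2^-1 * q -> 2 * u <= p + q.
Proof. lra. Qed.

(** [u], [v], [w] are the forms of [C # D], [C], [D]; [p] and [q] are those of [C #_t D] and
    [C #_(1-t) D]. *)
Lemma symmetric_sum_le (R : realFieldType) (t p q u v w : R) :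
  v <= u -> p <= (1 - t) * v + t * w ->
  q <= (1 - (1 - t)) * v + (1 - t) * w -> p + q <= 2 * (2^-1 * (u + w)).
Proof. lra. Qed.

Section Main.
Variables (R : realType) (H : hilbertType R) (H_nt : exists x : H, x != 0).
Local Notation B := (bop H_nt).
Variables (I : interval R) (f : R -> R) (A D : B) (a b : R).
Hypotheses (a0 : 0 < a) (abI : forall x, a <= x <= b -> x \in I).
Hypotheses (f_convex : op_geom_convex H I f).
Hypotheses (Aab : sa_within a b A) (Dab : sa_within a b D).
Implicit Types (S T : B) (t : R).

Let cf : {within `[a, b], continuous f}.
Proof.
have [cI _ _] := f_convex; apply: continuous_subspaceW cI => x /=.
by rewrite in_itv; exact: abI.
Qed.

Let f_gt0 x : a <= x <= b -> 0 < f x.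
Proof. by move=> /abI; have [_ + _] := f_convex; exact. Qed.

Let mean_within t : 0 <= t <= 1 -> sa_within a b (gm t A D).
Proof. exact: gm_within. Qed.

Lemma cfc_gmean t : 0 <= t <= 1 -> cfc f (gmean t A D) = fc f (gm t A D).
Proof.
by move=> t01; rewrite (gmean_gm a0 Aab a0 Dab) (cfc_fc (mean_within t01) cf).
Qed.

Lemma gmean_cfc t T S : sa_within a b T -> sa_within a b S ->
  gmean t (cfc f T) (cfc f S) = gm t (fc f T) (fc f S).
Proof.
move=> Tab Sab; rewrite (cfc_fc Tab cf) (cfc_fc Sab cf).
have [c [d [c0 Tcd]]] := fc_pos Tab cf f_gt0.
have [c' [d' [c0' Scd]]] := fc_pos Sab cf f_gt0.
by rewrite (gmean_gm c0 Tcd c0' Scd).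
Qed.

(** For arbitrary [T] and [S], as it is applied to [A #_t D] and [A #_(1-t) D] as well as to [A] and
    [D]. *)
Lemma fc_gm_le t T S : 0 <= t <= 1 -> sa_within a b T -> sa_within a b S ->
  ple (fc f (gm t T S)) (gm t (fc f T) (fc f S)).
Proof.
move=> t01 Tab Sab; have [_ _ conv] := f_convex.
have := conv t T S t01 (within_strictly_positive a0 Tab)
  (within_strictly_positive a0 Sab) (within_Sp_sub abI Tab) (within_Sp_sub abI Sab).
have TS := gm_within a0 Tab Sab t01.
rewrite gmean_cfc// (gmean_gm a0 Tab a0 Sab) (cfc_fc TS cf).
have [c [d [c0 Tcd]]] := fc_pos Tab cf f_gt0.
have [c' [d' [c0' Scd]]] := fc_pos Sab cf f_gt0.
have [c2 [d2 [_ [sG _ _]]]] := gm_pos c0 Tcd c0' Scd t.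
by move=> /(op_leP (fc_sa TS cf) sG).
Qed.

Lemma fc_gm_half_le t x : 0 <= t <= 1 ->
  2 * qf (fc f (gm 2^-1 A D)) x <=
  qf (fc f (gm t A D)) x + qf (fc f (gm (1 - t) A D)) x.
Proof.
move=> t01; have t01' : 0 <= 1 - t <= 1 by case/andP: t01; lra.
have h01 : 0 <= (2^-1 : R) <= 1 by lra.
have Pab := mean_within t01; have Qab := mean_within t01'.
have h1 := fc_gm_le h01 Pab Qab x; rewrite (gm_gm _ a0 Aab a0 Dab) in h1.
have [c [d [c0 Tcd]]] := fc_pos Pab cf f_gt0.
have [c' [d' [c0' Scd]]] := fc_pos Qab cf f_gt0.
have h2 := gm_le_arith c0 Tcd c0' Scd x h01.
exact: midpoint_le h1 h2.
Qed.

Lemma unif_cont_fc_gm : unif_cont01 (fun t => fc f (gm t A D)).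
Proof.
move=> e e0; have [d d0 fd] := fc_unif H_nt cf e0.
have [K K0 AK] := gm_lip a0 Aab a0 Dab.
exists (d / (K + 1)); first by rewrite divr_gt0// ltr_wpDl.
move=> s t s01 t01 st; apply: fd; [exact: mean_within|exact: mean_within|].
apply: nle_weak (AK s t s01 t01).
exact: lipschitz_modulus st.
Qed.

Lemma unif_cont_gm_fc : unif_cont01 (fun t => gm t (fc f A) (fc f D)).
Proof.
have [c [d [c0 Tcd]]] := fc_pos Aab cf f_gt0.
have [c' [d' [c0' Scd]]] := fc_pos Dab cf f_gt0.
have [K K0 AK] := gm_lip c0 Tcd c0' Scd.
move=> e e0; exists (e / (K + 1)); first by rewrite divr_gt0// ltr_wpDl.
move=> s t s01 t01 st; apply: nle_weak (AK s t s01 t01).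
exact: lipschitz_modulus st.
Qed.

Lemma hermite_hadamard :
  (op_le (cfc f (gmean 2^-1 A D)) (opint (fun t => cfc f (gmean t A D)) 0 1) /\
   op_le (opint (fun t => cfc f (gmean t A D)) 0 1)
         (opint (fun t => gmean t (cfc f A) (cfc f D)) 0 1)) /\
  (op_le (cfc f A) (cfc f D) ->
   op_le (opint (fun t => cfc f (gmean t A D)) 0 1)
         (opint (fun t => gmean t (cfc f A) (cfc f D)) 0 1) /\
   op_le (opint (fun t => gmean t (cfc f A) (cfc f D)) 0 1)
         (2^-1 *: (gmean 2^-1 (cfc f A) (cfc f D) + cfc f D))).
Proof.
have [c [d [c0 Acd]]] := fc_pos Aab cf f_gt0.
have [c' [d' [c0' Dcd]]] := fc_pos Dab cf f_gt0.
have h01 : 0 <= (2^-1 : R) <= 1 by lra.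
have sF t : 0 <= t <= 1 -> sa (fc f (gm t A D)).
  by move=> /mean_within/fc_sa; apply.
have sG t : 0 <= t <= 1 -> sa (gm t (fc f A) (fc f D)).
  by move=> _; have [? [? [_ []]]] := gm_pos c0 Acd c0' Dcd t.
have [S -> SF] := opintP unif_cont_fc_gm cfc_gmean.
have [T -> TG] := opintP unif_cont_gm_fc (fun t _ => gmean_cfc t Aab Dab).
have sS := integral_sa SF sF; have sT := integral_sa TG sG.
rewrite cfc_gmean// !gmean_cfc// (cfc_fc Aab cf) (cfc_fc Dab cf).
have ST : op_le S T.
  apply/op_leP => //; apply: integral_mono SF TG _ => t t01.
  exact: fc_gm_le.
split; first split=> //.
  apply/op_leP => //; first exact: sF.
  by move=> x; apply: (integral_ge SF) => t; exact: fc_gm_half_le.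
have [sA _ _] := Acd; have [sD _ _] := Dcd.
move=> /op_leP-/(_ sA sD) AD; split => //.
(* The factor [2^-1] is a complex scalar; the lemmas on forms expect an embedded real one. *)
have -> : 2^-1 *: (bfun (gm 2^-1 (fc f A) (fc f D)) + bfun (fc f D)) =
    bfun ((2^-1)%:C *: (gm 2^-1 (fc f A) (fc f D) + fc f D)).
  by rewrite fmorphV rmorph_nat.
apply/op_leP => //; first by apply/sa_scale/sa_add => //; exact: sG.
move=> x; apply: (integral_le TG) => t t01.
have t01' : 0 <= 1 - t <= 1 by case/andP: t01; lra.
rewrite qf_scale qf_add.
exact: symmetric_sum_le (gm_half_ge c0 Acd c0' Dcd AD x)
  (gm_le_arith c0 Acd c0' Dcd x t01) (gm_le_arith c0 Acd c0' Dcd x t01').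
Qed.

End Main.

Theorem theorem2p7 (R : realType) (H : hilbertType R) (I : interval R)
    (f : R -> R) (A B : H -> H)
    (I_pos : forall x : R, x \in I -> 0 < x)
    (f_convex : op_geom_convex H I f)
    (A_pos : strictly_positive A) (B_pos : strictly_positive B)
    (Sp_A : Sp_sub A I) (Sp_B : Sp_sub B I) :
  (op_le (cfc f (gmean 2^-1 A B))
         (opint (fun t => cfc f (gmean t A B)) 0 1) /\
   op_le (opint (fun t => cfc f (gmean t A B)) 0 1)
         (opint (fun t => gmean t (cfc f A) (cfc f B)) 0 1)) /\
  (op_le (cfc f A) (cfc f B) ->
   op_le (opint (fun t => cfc f (gmean t A B)) 0 1)
         (opint (fun t => gmean t (cfc f A) (cfc f B)) 0 1) /\
   op_le (opint (fun t => gmean t (cfc f A) (cfc f B)) 0 1)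
         (2^-1 *: (gmean 2^-1 (cfc f A) (cfc f B) + cfc f B))).
Proof.
(* On the zero space there is no ring of operators, but every order relation holds, since all inner
   products vanish. *)
have [H_nt|H_trivial] := pselect (exists x : H, x != 0); last first.
  have le (S T : H -> H) : op_le S T.
    move=> x; have -> : x = 0.
      by apply/eqP/negPn/negP => x0; apply: H_trivial; exists x.
    by rewrite linear0r.
  by split=> [|_]; split; exact: le.
have [[bA _] [bB _]] := (A_pos, B_pos).
pose A' := mkbop H_nt bA; pose B' := mkbop H_nt bB.
have sA : sa A' := @strictly_positive_sa _ _ _ A' A_pos.
have sB : sa B' := @strictly_positive_sa _ _ _ B' B_pos.
have [a [b [aI bI Aab]]] := Sp_sub_within sA Sp_A.
have [c [d [cI dI Bcd]]] := Sp_sub_within sB Sp_B.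
(* [A] and [B] need common bounds; those lie in [I] because [I] is convex. *)
have minI : Num.min a c \in I by rewrite minEle; case: ifP.
have maxI : Num.max b d \in I by rewrite maxEle; case: ifP.
apply: (@hermite_hadamard R H H_nt I f A' B' (Num.min a c) (Num.max b d)) => //.
- exact: I_pos.
- by move=> x xab; apply: (interval_is_interval minI maxI).
- by apply: sa_within_weak Aab; rewrite ?ge_min ?le_max lexx.
- by apply: sa_within_weak Bcd; rewrite ?ge_min ?le_max lexx orbT.
Qed.
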